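(* For all integers $d,k\ge 2$, the Neretin group $\mathcal N_{d,k}$ is an isolated point of the Chabauty space $\mathrm{Sub}(\mathcal N_{d,k})$ of its closed subgroups.
   Context: Neretin groups. Let $d,k\ge 2$ be integers and let $\mathcal T_{d,k}$ be the rooted tree in which the root has $k$ descendants and every other vertex has $d$ descendants. An almost automorphism of $\mathcal T_{d,k}$ is a triple $(A,B,\varphi)$ where $A,B$ are finite subtrees of $\mathcal T_{d,k}$ containing the root with $|\partial A|=|\partial B|$ (here $\partial A$ may be taken to be the set of vertices outside $A$ adjacent to $A$, i.e. the complements $\mathcal T_{d,k}\setminus A$ and $\mathcal T_{d,k}\setminus B$ have the same number of connected components) and $\varphi:\mathcal T_{d,k}\setminus A\to\mathcal T_{d,k}\setminus B$ is an isomorphism of forests. Two triples $(A,B,\varphi)$, $(A',B',\varphi')$ are identified if there is a finite subtree $A''\supseteq A\cup A'$ such that $\varphi$ and $\varphi'$ coincide on $\mathcal T_{d,k}\setminus A''$. The set of equivalence classes is a group $\mathcal N_{d,k}$ under composition, the Neretin group; it acts faithfully by homeomorphisms on the space of ends $\partial\mathcal T_{d,k}$. It carries a unique locally compact group topology for which the inclusion of the profinite group $\mathrm{Aut}(\mathcal T_{d,k})$ (automorphisms of the rooted tree) is continuous and open; it is always endowed with this topology. For a locally compact group $G$, $\mathrm{Sub}(G)$ is the set of closed subgroups of $G$ with the (compact) Chabauty topology. *)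

(* Defs.v *)
From HB Require Import structures.
From mathcomp Require Import all_boot finmap.
From mathcomp Require Import all_classical topology.

Set Implicit Arguments.
Unset Strict Implicit.
Unset Printing Implicit Defensive.

Local Open Scope classical_set_scope.
Local Open Scope card_scope.
Local Open Scope quotient_scope.

HB.mixin Record Group_isTopological G of Group G & Topological G := {
  mulg_continuous : continuous (fun x : G * G => (x.1 * x.2)%g);
  invg_continuous : continuous (fun x : G => x^-1%g) }.

#[short(type="topologicalGroupType")]
HB.structure Definition TopologicalGroup :=
  {G of Group G & Topological G & Group_isTopological G}.

Record closed_subgroup (G : topologicalGroupType) := ClosedSubgroup {
  csub_set :> set G;
  csub_group : group_closed (mem csub_set);
  csub_closed : closed csub_set }.

Section Chabauty.
Variable G : topologicalGroupType.

HB.instance Definition _ := gen_eqMixin (closed_subgroup G).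
HB.instance Definition _ := gen_choiceMixin (closed_subgroup G).

(* subbase: the sets of closed subgroups meeting a given open set, and the    *)
(* sets of closed subgroups disjoint from a given compact set                 *)
Definition chabauty_index : set (bool * set G) :=
  [set i | if i.1 then open i.2 else compact i.2].

Definition chabauty_subbase (i : bool * set G) : set (closed_subgroup G) :=
  if i.1 then [set H | csub_set H `&` i.2 !=set0]
  else [set H | csub_set H `&` i.2 = set0].

HB.instance Definition _ := isSubBaseTopological.Build (closed_subgroup G)
  chabauty_index chabauty_subbase.

Lemma full_group_closed : group_closed (mem [set: G]).
Proof. by split=> [|x y _ _]; exact/mem_set. Qed.

Definition full_subgroup : closed_subgroup G :=
  ClosedSubgroup full_group_closed (@closedT G).

End Chabauty.

Section Tree.
Variables d k : nat.

(* A vertex of the rooted tree is either the root [None], or [Some (i, s)]:   *)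
(* the first step from the root is the child i < k, and the following steps   *)
(* are those of s, each one < d, the LAST step being at the head of s.        *)
Definition vertex : Type := option ('I_k * seq 'I_d).

Definition vroot : vertex := None.

Definition parent (v : vertex) : vertex :=
  if v is Some (i, _ :: s) then Some (i, s) else vroot.

Definition child (u v : vertex) : bool := (v != vroot) && (parent v == u).

Definition adj (u v : vertex) : bool := child u v || child v u.

(* finite subtree (connected subgraph) containing the root *)
Definition subtree (A : set vertex) : Prop :=
  [/\ finite_set A, A vroot &
      forall v, A v -> exists p, [/\ path adj vroot p, last vroot p = v &
                                    forall u, u \in p -> A u]].

Definition boundary (A : set vertex) : set vertex :=
  [set v | ~ A v /\ exists2 u, A u & adj u v].

(* Only the restriction of [aa_fun] to the complement of [aa_dom] is          *)
(* meaningful; the identification [aa_equiv] below forgets the other values.  *)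
Record almost_aut := AlmostAut {
  aa_dom : set vertex;
  aa_cod : set vertex;
  aa_fun :> vertex -> vertex;
  aa_dom_subtree : subtree aa_dom;
  aa_cod_subtree : subtree aa_cod;
  aa_boundary : boundary aa_dom #= boundary aa_cod;
  aa_bij : set_bij (~` aa_dom) (~` aa_cod) aa_fun;
  aa_adj : forall u v, ~ aa_dom u -> ~ aa_dom v ->
    adj (aa_fun u) (aa_fun v) = adj u v }.

Definition aa_equiv (f g : almost_aut) : Prop :=
  exists C, [/\ subtree C, aa_dom f `<=` C, aa_dom g `<=` C &
                forall v, ~ C v -> f v = g v].

HB.instance Definition _ := gen_eqMixin almost_aut.
HB.instance Definition _ := gen_choiceMixin almost_aut.

Record tree_aut := TreeAut {
  ta_fun :> vertex -> vertex;
  ta_bij : bijective ta_fun;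
  ta_root : ta_fun vroot = vroot;
  ta_adj : forall u v, adj (ta_fun u) (ta_fun v) = adj u v }.

HB.instance Definition _ := gen_eqMixin tree_aut.
HB.instance Definition _ := gen_choiceMixin tree_aut.

Lemma adj_sym u v : adj u v = adj v u.
Proof. by rewrite /adj orbC. Qed.

Definition depth (v : vertex) : nat := if v is Some (_, s) then (size s).+1 else 0.

Lemma depth_parent v : v != vroot -> depth v = (depth (parent v)).+1.
Proof. by case: v => [[i [|j s]]|]. Qed.

Definition pclosed (A : set vertex) : Prop :=
  [/\ finite_set A, A vroot & forall v, A v -> A (parent v)].

Lemma pclosed_path A v : pclosed A -> A v ->
  exists p, [/\ path adj vroot p, last vroot p = v & forall u, u \in p -> A u].
Proof.
case=> _ A0 Apar; move: {2}(depth v) (erefl (depth v)) => n.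
elim: n v => [|n IHn] v dv Av.
  by case: v dv Av => [[]|] //= _ _; exists [::].
have vN : v != vroot by case: (v) dv => [[]|].
have [|p [pp lp pA]] := IHn (parent v) _ (Apar _ Av).
  by move: dv; rewrite depth_parent// => -[].
exists (rcons p v); split.
- by rewrite rcons_path pp lp /adj /child vN eqxx.
- by rewrite last_rcons.
- by move=> u; rewrite mem_rcons inE => /predU1P[->//|/pA].
Qed.

Lemma path_pclosed (A : set vertex) p : path adj vroot p -> A vroot ->
  (forall u, u \in p -> A u) -> forall n, A (iter n parent (last vroot p)).
Proof.
elim/last_ind: p => [|p v IHp] pp A0 pA n.
  by rewrite (_ : iter n _ _ = vroot)//; elim: n => //= n ->.
move: pp; rewrite rcons_path last_rcons => /andP[pp].
have pA' u : u \in p -> A u by move=> up; apply: pA; rewrite mem_rcons inE up orbT.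
have {}IHp := IHp pp A0 pA'.
case/orP => /andP[_ /eqP e].
  by case: n => [|n] /=; [apply: pA; rewrite mem_rcons mem_head|rewrite -iterS iterSr e].
by rewrite -e -iterSr.
Qed.

Lemma subtreeP A : subtree A <-> pclosed A.
Proof.
split=> -[Af A0 HA]; split=> // v Av; last exact: pclosed_path.
have [p [pp <- pA]] := HA _ Av.
exact: (path_pclosed pp A0 pA 1).
Qed.


Lemma subtreeU A B : subtree A -> subtree B -> subtree (A `|` B).
Proof.
move=> /subtreeP[Af A0 Ap] /subtreeP[Bf B0 Bp]; apply/subtreeP; split.
- by rewrite finite_setU.
- by left.
- by move=> v [/Ap|/Bp]; [left|right].
Qed.

Lemma subtree1 : subtree [set vroot].
Proof. by apply/subtreeP; split=> // v ->. Qed.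

Lemma iter_parent n v : depth v <= n -> iter n parent v = vroot.
Proof.
elim: n v => [|n IHn] v; first by case: v => [[]|].
have [-> _|v0] := eqVneq v vroot; first by rewrite iterSr; exact: IHn.
by rewrite depth_parent// iterSr; exact: IHn.
Qed.

Lemma subtree_hull F : finite_set F -> exists2 A, subtree A & F `<=` A.
Proof.
move=> Ff.
exists (\bigcup_(v in F) [set iter n parent v | n in `I_(depth v).+1] `|` [set vroot]);
  last by move=> v Fv; left; exists v => //; exists 0.
apply/subtreeP; split.
- rewrite finite_setU; split => //; apply: bigcup_finite => // v _.
  by apply: finite_image; exact: finite_II.
- by right.
move=> _ [[v Fv [n /= nv <-]]|->]; last by right.
rewrite -iterS; have [nv1|nv1] := ltnP n.+1 (depth v).+1.
  by left; exists v => //; exists n.+1.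
have {nv nv1} -> : n = depth v by apply/eqP; rewrite eqn_leq -ltnS nv -ltnS nv1.
by right; apply: iter_parent.
Qed.

Definition succs (v : vertex) : seq vertex :=
  if v is Some (i, s) then [seq Some (i, j :: s) | j <- enum 'I_d]
  else [seq Some (i, [::]) | i <- enum 'I_k].

Lemma mem_succs u v : (v \in succs u) = child u v.
Proof.
rewrite /child; case: u => [[i s]|] /=.
  apply/mapP/andP => [[j _ ->]|[]] //=.
  case: v => [[i' [|j s']]|]//= _ /eqP[-> ->].
  by exists j => //; rewrite mem_enum.
apply/mapP/andP => [[j _ ->]|[]] //=.
case: v => [[i [|j s]]|]//= _ _.
by exists i => //; rewrite mem_enum.
Qed.

Lemma size_succs u : u != vroot -> size (succs u) = d.
Proof. by case: u => [[i s]|]//= _; rewrite size_map -cardE card_ord. Qed.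

Lemma uniq_succs u : uniq (succs u).
Proof.
by case: u => [[i s]|]/=; rewrite map_inj_uniq ?enum_uniq// => x y [].
Qed.

Definition isoT (A B : set vertex) (f : vertex -> vertex) :=
  [/\ pclosed A, pclosed B, set_bij (~` A) (~` B) f &
   forall u v, ~ A u -> ~ A v -> adj (f u) (f v) = adj u v].

Definition nbs (A : set vertex) u : seq vertex :=
  (if `[< A (parent u) >] then [::] else [:: parent u]) ++ succs u.

Lemma notroot (A : set vertex) u : pclosed A -> ~ A u -> u != vroot.
Proof. by case=> _ A0 _; apply: contra_notN => /eqP->. Qed.

Lemma child_out (A : set vertex) u v : pclosed A -> ~ A u -> child u v -> ~ A v.
Proof. by move=> [_ _ Ap] Au /andP[_ /eqP uv] /Ap; rewrite uv. Qed.

Lemma mem_nbs A u v : pclosed A -> ~ A u -> (v \in nbs A u) <-> ~ A v /\ adj u v.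
Proof.
move=> pA Au; rewrite /nbs mem_cat mem_succs; split.
  case/orP => [|uv]; last by split; [exact: child_out uv|rewrite /adj uv].
  case: asboolP => // Ap; rewrite inE => /eqP->; split=> //.
  by rewrite /adj /child (notroot pA Au) eqxx orbT.
move=> [Av /orP[->|]]; first by rewrite orbT.
case/andP => _ /eqP uv; case: asboolP; rewrite uv// => _.
by rewrite inE eqxx.
Qed.

Lemma depth_child u v : child u v -> depth v = (depth u).+1.
Proof. by case/andP => v0 /eqP <-; exact: depth_parent. Qed.

Lemma neqSS n : n = n.+2 -> False.
Proof. by elim: n => // n IHn [/IHn]. Qed.

Lemma uniq_nbs A u : pclosed A -> ~ A u -> uniq (nbs A u).
Proof.
move=> pA Au; rewrite /nbs; case: asboolP => // _; rewrite ?uniq_succs//.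
rewrite /= uniq_succs andbT mem_succs; apply/negP => /depth_child e.
by have := depth_parent (notroot pA Au); rewrite e => /neqSS.
Qed.

Lemma size_nbs A u : pclosed A -> ~ A u -> size (nbs A u) = ~~ `[< A (parent u) >] + d.
Proof.
move=> pA Au; rewrite /nbs size_cat size_succs ?(notroot pA)//.
by case: asboolP.
Qed.

Lemma iso_out A B f u : isoT A B f -> ~ A u -> ~ B (f u).
Proof. by move=> [_ _ [fAB _ _] _]; exact: fAB. Qed.

Lemma iso_inj A B f u v : isoT A B f -> ~ A u -> ~ A v -> f u = f v -> u = v.
Proof. by move=> [_ _ [_ fi _] _] Au Av; apply: fi; rewrite inE. Qed.

Lemma iso_bd A B f u : isoT A B f -> ~ A u -> B (parent (f u)) <-> A (parent u).
Proof.
move=> iso Au; have [pA pB [fAB fi fs] fadj] := iso.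
have fu := iso_out iso Au.
have/perm_size : perm_eq (map f (nbs A u)) (nbs B (f u)).
  apply: uniq_perm; rewrite ?uniq_nbs//.
    rewrite map_inj_in_uniq ?uniq_nbs// => x y /(mem_nbs _ pA Au)[Ax _].
    by move=> /(mem_nbs _ pA Au)[Ay _]; exact: iso_inj iso _ _.
  move=> w; apply/mapP/idP => [[v /(mem_nbs _ pA Au)[Av uv] ->]|].
    by apply/(mem_nbs _ pB fu); rewrite fadj//; split=> //; exact: fAB.
  move=> /(mem_nbs _ pB fu)[Bw]; have [v Av <-] := fs _ Bw.
  rewrite fadj// => uv.
  by exists v => //; apply/(mem_nbs _ pA Au).
rewrite size_map !size_nbs// => /eqP; rewrite eqn_add2r.
by case: asboolP; case: asboolP.
Qed.

Lemma adj_cases u v : u != vroot -> adj u v -> parent u = v \/ child u v.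
Proof. by move=> u0 /orP[|/andP[_ /eqP]]; [right|left]. Qed.

Lemma iso_parent A B f u : isoT A B f -> ~ A u -> ~ A (parent u) ->
  f (parent u) = parent (f u).
Proof.
move=> iso; have [pA pB [fAB fi fs] fadj] := iso.
move: {2}(depth u) (erefl (depth u)) => n; elim: n u => [|n IHn] u du Au Apu.
  by have := notroot pA Au; case: (u) du => [[]|].
have u0 := notroot pA Au.
have fu0 := notroot pB (fAB _ Au).
have : adj (f u) (f (parent u)) by rewrite fadj// /adj /child u0 eqxx orbT.
case/(adj_cases fu0) => [->//|/andP[fp0 /eqP ffp]].
have dp : depth (parent u) = n by move: du; rewrite depth_parent// => -[].
have App : ~ A (parent (parent u)).
  by move=> /(iso_bd iso Apu); rewrite ffp => /(fAB _ Au).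
have := IHn _ dp Apu App; rewrite ffp => /(iso_inj iso App Au) e.
have p0 := notroot pA Apu.
by have := depth_parent p0; rewrite e dp du => /neqSS.
Qed.

Lemma iso_img A B f C : isoT A B f -> pclosed C -> A `<=` C ->
  pclosed (B `|` f @` (C `\` A)).
Proof.
move=> iso [Cf C0 Cp] AC; have [_ pB [fAB fi fs] _] := iso.
have [Bf B0 Bp] := pB.
split; [|by left|].
  by rewrite finite_setU; split=> //; apply/finite_image/finite_setD.
move=> w [/Bp|[v [Cv Av] <-{w}]]; first by left.
have [Apv|Apv] := pselect (A (parent v)).
  by left; apply/(iso_bd iso Av).
by right; exists (parent v); [split=> //; exact: Cp|exact: iso_parent iso _ _].
Qed.

Lemma boundaryE A v : pclosed A -> boundary A v <-> ~ A v /\ A (parent v).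
Proof.
move=> pA; split=> -[Av].
  case=> u Au /orP[|]; first by case/andP => _ /eqP ->.
  by case/andP => u0 /eqP uv; move: Av; rewrite -uv; case: pA => _ _ /(_ _ Au).
move=> Ap; split=> //; exists (parent v) => //.
by rewrite /adj /child (notroot pA Av) eqxx.
Qed.

Lemma iso_boundary A B f : isoT A B f -> boundary A #= boundary B.
Proof.
move=> iso; have [pA pB [fAB fi fs] _] := iso.
have <- : f @` boundary A = boundary B.
  apply/seteqP; split=> [_ [v /(boundaryE _ pA)[Av Apv] <-]|w].
    by apply/boundaryE => //; split; [exact: fAB|apply/(iso_bd iso Av)].
  move=> /(boundaryE _ pB)[Bw Bpw]; have [v Av vw] := fs _ Bw.
  by exists v => //; apply/boundaryE => //; split=> //; apply/(iso_bd iso Av); rewrite vw.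
rewrite card_eq_sym; apply: inj_card_eq => u v; rewrite !inE.
by move=> /(boundaryE _ pA)[Au _] /(boundaryE _ pA)[Av _]; exact: iso_inj iso _ _.
Qed.

Definition mkaa A B f (h : isoT A B f) : almost_aut :=
  let: And4 pA pB fb fa := h in
  AlmostAut (proj2 (subtreeP A) pA) (proj2 (subtreeP B) pB) (iso_boundary h) fb fa.

Lemma mkaa_dom A B f (h : isoT A B f) : aa_dom (mkaa h) = A.
Proof. by rewrite /mkaa; case: h. Qed.
Lemma mkaa_cod A B f (h : isoT A B f) : aa_cod (mkaa h) = B.
Proof. by rewrite /mkaa; case: h. Qed.
Lemma mkaaE A B f (h : isoT A B f) : mkaa h = f :> (_ -> _).
Proof. by rewrite /mkaa; case: h. Qed.

Lemma aa_iso (f : almost_aut) : isoT (aa_dom f) (aa_cod f) f.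
Proof.
case: f => A B f /= /subtreeP sA /subtreeP sB _ fb fa; by split.
Qed.

Lemma iso_id A : pclosed A -> isoT A A id.
Proof. by move=> pA; split=> //; split=> [//|//|v Av]; exists v. Qed.

Lemma pclosed1 : pclosed [set vroot].
Proof. exact/subtreeP/subtree1. Qed.

Definition aa_one : almost_aut := mkaa (iso_id pclosed1).

Definition invf (A : set vertex) (f : vertex -> vertex) (w : vertex) : vertex :=
  xget vroot [set v | ~ A v /\ f v = w].

Lemma invfP A B f w : isoT A B f -> ~ B w -> ~ A (invf A f w) /\ f (invf A f w) = w.
Proof.
move=> [_ _ [_ _ fs] _] /fs[v Av fv]; rewrite /invf.
by case: xgetP => [x _ //|/(_ v)[]].
Qed.

Lemma invfK A B f v : isoT A B f -> ~ A v -> invf A f (f v) = v.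
Proof.
move=> iso Av; have [A' e] := invfP iso (iso_out iso Av).
exact: iso_inj iso A' Av e.
Qed.

Lemma iso_inv A B f : isoT A B f -> isoT B A (invf A f).
Proof.
move=> iso; have [pA pB [fAB fi fs] fadj] := iso; split=> //.
  split.
  - by move=> w /(invfP iso)[].
  - move=> w w'; rewrite !inE => Bw Bw' e.
    by rewrite -(invfP iso Bw).2 e (invfP iso Bw').2.
  - by move=> v Av; exists (f v); [exact: fAB|exact: invfK iso _].
move=> u v Bu Bv; have [Au eu] := invfP iso Bu; have [Av ev] := invfP iso Bv.
by rewrite -fadj// eu ev.
Qed.

Definition aa_inv (f : almost_aut) : almost_aut := mkaa (iso_inv (aa_iso f)).

Lemma iso_comp A B f A' B' g : isoT A B f -> isoT A' B' g ->
  isoT (A' `|` invf A' g @` ((A `|` B') `\` B'))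
       (B `|` f @` ((A `|` B') `\` A)) (f \o g).
Proof.
move=> fiso giso; have giso' := iso_inv giso.
have [pA pB [fAB fi fs] fadj] := fiso; have [pA' pB' [gAB gi gs] gadj] := giso.
have pAB : pclosed (A `|` B') by apply/subtreeP/subtreeU; exact/subtreeP.
have domP v : ~ (A' `|` invf A' g @` ((A `|` B') `\` B')) v -> ~ A' v /\ ~ A (g v).
  move=> /not_orP[A'v H]; split=> // Agv; apply: H; exists (g v).
    by split; [left|exact: gAB].
  exact: invfK giso _.
split.
- by apply: iso_img => // v; right.
- by apply: iso_img => // v; left.
- split.
  + move=> v /domP[A'v Agv] [|[w [ABw Aw] /= e]]; first exact: fAB.
    have e' := iso_inj fiso Aw Agv e.
    by case: ABw => // ; rewrite e'; exact: gAB.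
  + move=> u v; rewrite !inE => /domP[A'u Au] /domP[A'v Av] /= e.
    exact: (iso_inj giso A'u A'v (iso_inj fiso Au Av e)).
  + move=> w /not_orP[Bw H]; have [x Ax fx] := fs _ Bw.
    have B'x : ~ B' x by move=> B'x; apply: H; exists x => //; split=> //; right.
    have [v A'v gv] := gs _ B'x; exists v => /=; last by rewrite gv.
    move=> [//|[y [[Ay|//] B'y] yv]].
    by apply: Ax; rewrite -gv -yv (invfP giso B'y).2.
- by move=> u v /domP[A'u Au] /domP[A'v Av] /=; rewrite fadj// gadj.
Qed.

Definition aa_comp (f g : almost_aut) : almost_aut :=
  mkaa (iso_comp (aa_iso f) (aa_iso g)).

Implicit Types f g h : almost_aut.

Lemma aa_compE f g : aa_comp f g = f \o g :> (_ -> _).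
Proof. exact: mkaaE. Qed.

Lemma aa_oneE : aa_one = id :> (_ -> _).
Proof. exact: mkaaE. Qed.

Lemma aa_invE f : aa_inv f = invf (aa_dom f) f :> (_ -> _).
Proof. exact: mkaaE. Qed.

(* Since the required finite subtree can be enlarged at will, it is enough to *)
(* agree outside a finite set.                                                *)
Lemma aa_equivP f g : aa_equiv f g <->
  exists2 F, finite_set F & forall v, ~ F v -> f v = g v.
Proof.
split=> [[C [/subtreeP[Cf _ _] _ _ fg]]|[F /subtree_hull[C sC FC] fg]].
  by exists C.
exists (C `|` (aa_dom f `|` aa_dom g)); split.
- by do ![apply: subtreeU => //]; exact: aa_dom_subtree.
- by move=> v; right; left.
- by move=> v; right; right.
- by move=> v /not_orP[Cv _]; apply: fg => /FC.
Qed.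

Lemma aa_equivE f g : (forall v, f v = g v) -> aa_equiv f g.
Proof. by move=> fg; apply/aa_equivP; exists set0. Qed.

Lemma finite_dom (f : almost_aut) : finite_set (aa_dom f).
Proof. by case: (aa_dom_subtree f). Qed.

Lemma finite_cod (f : almost_aut) : finite_set (aa_cod f).
Proof. by case: (aa_cod_subtree f). Qed.

Lemma aa_equiv_refl f : aa_equiv f f.
Proof. exact: aa_equivE. Qed.

Lemma aa_equiv_sym f g : aa_equiv f g -> aa_equiv g f.
Proof. by case=> C [? ? ? e]; exists C; split=> // v /e. Qed.

Lemma aa_equiv_trans g f h : aa_equiv f g -> aa_equiv g h -> aa_equiv f h.
Proof.
move=> /aa_equivP[F Ff e] /aa_equivP[G Gf e']; apply/aa_equivP.
exists (F `|` G); first by rewrite finite_setU.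
by move=> v /not_orP[/e -> /e'].
Qed.

Lemma finite_preim (g : almost_aut) F : finite_set F ->
  finite_set [set v | ~ aa_dom g v /\ F (g v)].
Proof.
move=> Ff; apply: (sub_finite_set _ (finite_image (invf (aa_dom g) g) Ff)).
by move=> v [Av Fgv]; exists (g v) => //; exact: invfK (aa_iso g) _.
Qed.

Lemma aa_comp_equiv f f' g g' : aa_equiv f f' -> aa_equiv g g' ->
  aa_equiv (aa_comp f g) (aa_comp f' g').
Proof.
move=> /aa_equivP[F Ff e] /aa_equivP[G Gf e']; apply/aa_equivP.
exists (aa_dom g `|` G `|` [set v | ~ aa_dom g v /\ F (g v)]).
  by rewrite !finite_setU; split; [split=> //; exact: finite_dom|exact: finite_preim].
move=> v /not_orP[/not_orP[Av Gv] H]; rewrite !aa_compE /= -e'// e//.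
by move=> Fgv; apply: H.
Qed.

Lemma aa_inv_equiv f g : aa_equiv f g -> aa_equiv (aa_inv f) (aa_inv g).
Proof.
move=> /aa_equivP[F Ff e]; apply/aa_equivP.
exists (aa_cod f `|` f @` (F `|` aa_dom g)).
  rewrite finite_setU; split; first exact: finite_cod.
  by apply: finite_image; rewrite finite_setU; split=> //; exact: finite_dom.
move=> w /not_orP[Bw H]; rewrite !aa_invE.
have [Av fv] := invfP (aa_iso f) Bw; set v := invf _ _ w in Av fv *.
have Fv : ~ (F `|` aa_dom g) v by move=> Fv; apply: H; exists v.
move: Fv => /not_orP[Fv gv].
by rewrite -fv e// (invfK (aa_iso g)).
Qed.

Lemma aa_compA f g h :
  aa_equiv (aa_comp f (aa_comp g h)) (aa_comp (aa_comp f g) h).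
Proof. by apply: aa_equivE => v; rewrite !aa_compE. Qed.

Lemma aa_comp1 f : aa_equiv (aa_comp f aa_one) f.
Proof. by apply: aa_equivE => v; rewrite aa_compE /= aa_oneE. Qed.

Lemma aa_1comp f : aa_equiv (aa_comp aa_one f) f.
Proof. by apply: aa_equivE => v; rewrite aa_compE /= aa_oneE. Qed.

Lemma aa_compV f : aa_equiv (aa_comp f (aa_inv f)) aa_one.
Proof.
apply/aa_equivP; exists (aa_cod f); first exact: finite_cod.
by move=> v Bv; rewrite aa_compE aa_oneE/= aa_invE; case: (invfP (aa_iso f) Bv).
Qed.

Lemma aa_Vcomp f : aa_equiv (aa_comp (aa_inv f) f) aa_one.
Proof.
apply/aa_equivP; exists (aa_dom f); first exact: finite_dom.
by move=> v Bv; rewrite aa_compE aa_oneE/= aa_invE; exact: invfK (aa_iso f) _.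
Qed.

Definition aa_rel : rel almost_aut := fun f g => `[< aa_equiv f g >].

Lemma aa_rel_refl : reflexive aa_rel.
Proof. by move=> f; apply/asboolP/aa_equiv_refl. Qed.

Lemma aa_rel_sym : symmetric aa_rel.
Proof. by move=> f g; apply: asbool_equiv_eq; split; exact: aa_equiv_sym. Qed.

Lemma aa_rel_trans : transitive aa_rel.
Proof.
by move=> g f h /asboolP fg /asboolP gh; apply/asboolP/(aa_equiv_trans fg gh).
Qed.

Canonical aa_equiv_rel := EquivRel aa_rel aa_rel_refl aa_rel_sym aa_rel_trans.

Definition neretin : Type := {eq_quot aa_equiv_rel}.

HB.instance Definition _ := Choice.on neretin.
HB.instance Definition _ := EqQuotient.on neretin.

Definition neretin_of (f : almost_aut) : neretin := \pi f.

Lemma neretin_ofP f g : neretin_of f = neretin_of g <-> aa_equiv f g.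
Proof.
split; first by move=> /eqmodP /asboolP.
by move=> fg; apply/eqmodP/asboolP.
Qed.

Definition neretin_mul (f g : neretin) := neretin_of (aa_comp (repr f) (repr g)).
Definition neretin_inv (f : neretin) := neretin_of (aa_inv (repr f)).
Definition neretin_one := neretin_of aa_one.

Lemma neretin_ofK f : aa_equiv (repr (neretin_of f)) f.
Proof. by apply/neretin_ofP; rewrite /neretin_of reprK. Qed.

Lemma neretin_repr (f : neretin) : neretin_of (repr f) = f.
Proof. exact: reprK. Qed.

Lemma neretin_mulE f g : neretin_mul (neretin_of f) (neretin_of g) = neretin_of (aa_comp f g).
Proof. by apply/neretin_ofP/aa_comp_equiv; exact: neretin_ofK. Qed.

Lemma neretin_invE f : neretin_inv (neretin_of f) = neretin_of (aa_inv f).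
Proof. by apply/neretin_ofP/aa_inv_equiv; exact: neretin_ofK. Qed.

Lemma neretin_mulA : associative neretin_mul.
Proof.
move=> f g h; rewrite -(neretin_repr f) -(neretin_repr g) -(neretin_repr h) !neretin_mulE.
exact/neretin_ofP/aa_compA.
Qed.

Lemma neretin_mul1 : left_id neretin_one neretin_mul.
Proof.
by move=> f; rewrite -(neretin_repr f) neretin_mulE; exact/neretin_ofP/aa_1comp.
Qed.

Lemma neretin_mulr1 : right_id neretin_one neretin_mul.
Proof.
by move=> f; rewrite -(neretin_repr f) neretin_mulE; exact/neretin_ofP/aa_comp1.
Qed.

Lemma neretin_mulV : left_inverse neretin_one neretin_inv neretin_mul.
Proof.
by move=> f; rewrite -(neretin_repr f) neretin_invE neretin_mulE; exact/neretin_ofP/aa_Vcomp.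
Qed.

Lemma neretin_mulrV : right_inverse neretin_one neretin_inv neretin_mul.
Proof.
by move=> f; rewrite -(neretin_repr f) neretin_invE neretin_mulE; exact/neretin_ofP/aa_compV.
Qed.

HB.instance Definition _ := isGroup.Build neretin neretin_mulA neretin_mul1 neretin_mulr1 neretin_mulV neretin_mulrV.

Lemma tree_autP (a b : tree_aut) : (forall v, a v = b v) -> a = b.
Proof.
case: a b => [a ab a0 aa] [b bb b0 ba] /= /funext e; subst b.
by congr TreeAut; exact: Prop_irrelevance.
Qed.

Definition ta_one : tree_aut :=
  TreeAut (Bijective (frefl id) (frefl id)) (erefl vroot) (fun u v => erefl (adj u v)).

Lemma ta_comp_root (a b : tree_aut) : (a \o b) vroot = vroot.
Proof. by rewrite /= !ta_root. Qed.

Lemma ta_comp_adj (a b : tree_aut) u v : adj ((a \o b) u) ((a \o b) v) = adj u v.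
Proof. by rewrite /= !ta_adj. Qed.

Definition ta_mul (a b : tree_aut) : tree_aut :=
  TreeAut (bij_comp (ta_bij a) (ta_bij b)) (ta_comp_root a b) (ta_comp_adj a b).

Lemma ta_inv_subproof (a : tree_aut) : exists b : tree_aut, cancel a b /\ cancel b a.
Proof.
have [g gK Kg] := ta_bij a.
have gb : bijective g by exists a.
have g0 : g vroot = vroot by rewrite -{1}(ta_root a) gK.
have gadj u v : adj (g u) (g v) = adj u v by rewrite -(ta_adj a) !Kg.
by exists (TreeAut gb g0 gadj).
Qed.

Definition ta_inv (a : tree_aut) : tree_aut := projT1 (cid (ta_inv_subproof a)).

Lemma ta_invK (a : tree_aut) : cancel a (ta_inv a).
Proof. by rewrite /ta_inv; case: cid => b []. Qed.

Lemma ta_Kinv (a : tree_aut) : cancel (ta_inv a) a.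
Proof. by rewrite /ta_inv; case: cid => b []. Qed.

Lemma ta_mulA : associative ta_mul.
Proof. by move=> a b c; exact: tree_autP. Qed.

Lemma ta_mul1 : left_id ta_one ta_mul.
Proof. by move=> a; exact: tree_autP. Qed.

Lemma ta_mulr1 : right_id ta_one ta_mul.
Proof. by move=> a; exact: tree_autP. Qed.

Lemma ta_mulV : left_inverse ta_one ta_inv ta_mul.
Proof. by move=> a; apply: tree_autP => v; exact: ta_invK. Qed.

Lemma ta_mulrV : right_inverse ta_one ta_inv ta_mul.
Proof. by move=> a; apply: tree_autP => v; exact: ta_Kinv. Qed.

HB.instance Definition _ :=
  isGroup.Build tree_aut ta_mulA ta_mul1 ta_mulr1 ta_mulV ta_mulrV.

(* topology of pointwise convergence on the discrete set of vertices, which   *)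
(* is the profinite topology of the automorphism group                        *)
Definition ta_eval (a : tree_aut) : {ptws vertex -> discrete_topology vertex} := a.

HB.instance Definition _ := Topological.copy tree_aut (initial_topology ta_eval).

Lemma ptws_cvg (f : {ptws vertex -> discrete_topology vertex}) V : nbhs f V ->
  exists2 F, finite_set F &
    forall g : vertex -> vertex, (forall v, F v -> g v = f v) -> V g.
Proof.
pose Ff : set_system {ptws vertex -> discrete_topology vertex} :=
  [set V | exists2 F, finite_set F &
    forall g : vertex -> vertex, (forall v, F v -> g v = f v) -> V g].
have FF : Filter Ff.
  split; first by exists set0.
    move=> P Q [F Ffin FP] [G Gfin GQ]; exists (F `|` G); first by rewrite finite_setU.
    move=> g gf; split; [apply: FP|apply: GQ] => v vF; apply: gf; [by left|by right].
  by move=> P Q PQ [F Ffin FP]; exists F => // g /FP /PQ.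
suff : Ff --> f by apply.
apply/cvg_sup => i; apply/cvg_image.
  by rewrite predeqE => w; split=> // _; exists (fun=> w).
move=> A /principal_filterP Afi; exists (@^~ i @^-1` A).
  by exists [set i] => // g gf; rewrite /preimage/= gf.
by apply: image_preimage; rewrite predeqE => w; split=> // _; exists (fun=> w).
Qed.

Lemma ta_nbhsP (a : tree_aut) (U : set tree_aut) : nbhs a U <->
  exists2 F, finite_set F & forall b : tree_aut, (forall v, F v -> b v = a v) -> U b.
Proof.
split.
  rewrite nbhsE => -[_ [[V oV <-] Va] VU].
  have {}/ptws_cvg[F Ff FV] : nbhs (ta_eval a) V by exact: open_nbhs_nbhs.
  by exists F => // b ba; apply/VU/FV.
move=> [F Ff FU].
apply: (@filterS _ (nbhs a) _ (\bigcap_(v in F) [set b : tree_aut | b v = a v])) => //.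
have [D ->] := finite_fsetP.1 Ff; apply: filter_bigI => v vD.
have H := @proj_continuous _ (fun=> discrete_topology vertex) v (ta_eval a).
have {}H := H [set a v] (@discrete_set1 (discrete_topology vertex) _).
exact: (@initial_continuous _ _ ta_eval a) H.
Qed.


Lemma aa_of_iso (a : tree_aut) : isoT [set vroot] [set vroot] a.
Proof.
have a0 v : a v = vroot <-> v = vroot.
  by split=> [|->]; [rewrite -{1}(ta_root a); apply: (bij_inj (ta_bij a))|exact: ta_root].
split; [exact: pclosed1|exact: pclosed1| |by move=> u v _ _; exact: ta_adj].
split; first by move=> v /= v0 /a0.
- by move=> u v _ _; exact: (bij_inj (ta_bij a)).
- by move=> w /= w0; exists (ta_inv a w); rewrite ?ta_Kinv//= => /a0; rewrite ta_Kinv.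
Qed.

Definition neretin_incl (a : tree_aut) : neretin := neretin_of (mkaa (aa_of_iso a)).

Lemma neretin_inclM (a b : tree_aut) :
  neretin_incl (a * b)%g = (neretin_incl a * neretin_incl b)%g.
Proof.
rewrite [RHS]neretin_mulE; apply/neretin_ofP/aa_equivE => v.
by rewrite aa_compE /= !mkaaE.
Qed.

Lemma neretin_incl1 : neretin_incl 1%g = 1%g.
Proof. by apply/neretin_ofP/aa_equivE => v; rewrite !mkaaE. Qed.

Lemma neretin_inclV (a : tree_aut) : neretin_incl a^-1%g = (neretin_incl a)^-1%g.
Proof.
by apply: (mulgI (neretin_incl a)); rewrite -neretin_inclM !mulgV neretin_incl1.
Qed.

(* The group topology for which [neretin_incl] is continuous and open: U is   *)
(* open iff, for all g, the set of all automorphisms a such that ga belongs   *)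
(* to U is open.                                                              *)
Definition neretin_open (U : set neretin) : Prop :=
  forall g : neretin, open [set a : tree_aut | U (g * neretin_incl a)%g].

Lemma neretin_openT : neretin_open setT.
Proof. by move=> g; exact: openT. Qed.

Lemma neretin_openI : setI_closed neretin_open.
Proof. by move=> U V oU oV g; exact: (openI (oU g) (oV g)). Qed.

Lemma neretin_open_bigU (I : Type) (U : I -> set neretin) :
  (forall i, neretin_open (U i)) -> neretin_open (\bigcup_i U i).
Proof. by move=> oU g; apply: (bigcup_open (fun i _ => oU i g)). Qed.

HB.instance Definition _ := isOpenTopological.Build neretin
  neretin_openT neretin_openI neretin_open_bigU.

Definition fixing (F : set vertex) : set tree_aut := [set a | forall v, F v -> a v = v].

Lemma fixing_subgroup_open F (a : tree_aut) : finite_set F -> nbhs a [set b | fixing F (a^-1 * b)%g].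
Proof.
move=> Ff; apply/ta_nbhsP; exists F => // b ba v Fv.
by rewrite /= ba// ta_invK.
Qed.

Lemma neretin_nbhsP (g : neretin) (U : set neretin) : nbhs g U <->
  exists2 F, finite_set F & forall a, fixing F a -> U (g * neretin_incl a)%g.
Proof.
split.
  rewrite nbhsE => -[V [oV Vg] VU].
  have : nbhs (1%g : tree_aut) [set a : tree_aut | V (g * neretin_incl a)%g].
    by apply: open_nbhs_nbhs; split; [exact: oV|rewrite /= neretin_incl1 mulg1].
  move=> /ta_nbhsP[F Ff FV]; exists F => // a aF; apply/VU/FV => v Fv.
  exact: aF.
move=> [F Ff FU]; rewrite nbhsE.
exists [set g * neretin_incl a | a in fixing F]%g; last by move=> _ [a aF <-]; exact: FU.
split; last by exists 1%g; rewrite // neretin_incl1 mulg1.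
move=> h; rewrite openE => a [b bF e].
have /= := fixing_subgroup_open a Ff; apply: filterS => c cF.
exists (b * (a^-1 * c))%g; first by move=> v Fv; rewrite -[LHS]/(b ((a^-1 * c)%g v)) cF// bF.
by rewrite neretin_inclM mulgA e !neretin_inclM neretin_inclV !mulgA mulgK.
Qed.

Lemma neretin_incl_continuous : continuous neretin_incl.
Proof.
apply/continuousP => U /(_ 1%g); congr open; apply/seteqP.
by split=> a /=; rewrite mul1g.
Qed.

Lemma neretin_incl_open (U : set tree_aut) : open U -> open (neretin_incl @` U).
Proof.
move=> oU; rewrite openE => _ [a Ua <-].
have /ta_nbhsP[F Ff FU] : nbhs a U by exact: open_nbhs_nbhs.
apply/neretin_nbhsP; exists F => // b bF; exists (a * b)%g; last exact: neretin_inclM.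
by apply: FU => v Fv /=; rewrite bF.
Qed.

Definition conj_fun (A : set vertex) (f : vertex -> vertex) (b : vertex -> vertex) v :=
  if `[< A v >] then v else invf A f (b (f v)).

Lemma finite_boundary A : pclosed A -> finite_set (boundary A).
Proof.
move=> pA; apply: (@sub_finite_set _ _ (\bigcup_(u in A) [set` succs u])).
  move=> v /(boundaryE _ pA)[Av Ap]; exists (parent v) => //=.
  by rewrite mem_succs /child eqxx (notroot pA Av).
by apply: bigcup_finite => [|u _]; [case: pA|exact: finite_seq].
Qed.

Lemma fixing_inv F (b : tree_aut) : fixing F b -> fixing F b^-1%g.
Proof. by move=> bF v Fv; rewrite -{1}(bF v Fv) ta_invK. Qed.

Lemma fixing_out (B : set vertex) (b : tree_aut) w : fixing B b -> ~ B w -> ~ B (b w).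
Proof. by move=> bB Bw Bbw; apply: Bw; have := fixing_inv bB Bbw; rewrite ta_invK => ->. Qed.

Lemma conj_funK A B f (b c : tree_aut) : isoT A B f -> fixing B b ->
  cancel b c -> cancel (conj_fun A f b) (conj_fun A f c).
Proof.
move=> iso bB bc v; rewrite /conj_fun.
case: (asboolP (A v)) => Av; first by case: asboolP.
have Bw := fixing_out bB (iso_out iso Av).
have [Aw ew] := invfP iso Bw.
by case: asboolP => // _; rewrite ew bc (invfK iso).
Qed.

Lemma conj_fun_out A B f (b : tree_aut) v : isoT A B f -> fixing B b -> ~ A v ->
  ~ A (conj_fun A f b v).
Proof.
move=> iso bB Av; rewrite /conj_fun; case: asboolP => // _.
by case: (invfP iso (fixing_out bB (iso_out iso Av))).
Qed.

Lemma conj_fun_adj A B f (b : tree_aut) u v : isoT A B f -> fixing (B `|` f @` boundary A) b ->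
  adj (conj_fun A f b u) (conj_fun A f b v) = adj u v.
Proof.
move=> iso bF; have bB : fixing B b by move=> w Bw; apply: bF; left.
have iso' := iso_inv iso.
have [pA pB [fAB _ _] fadj] := iso; have [_ _ _ gadj] := iso'.
have bdfix w : boundary A w -> conj_fun A f b w = w.
  move=> bw; have /(boundaryE _ pA)[Aw _] := bw.
  rewrite /conj_fun; case: asboolP => // _.
  by rewrite bF ?(invfK iso)//; right; exists w.
have key x y : A x -> ~ A y -> adj x (conj_fun A f b y) = adj x y.
  move=> Ax Ay; apply/idP/idP => xy; last first.
    by rewrite bdfix//; split=> //; exists x.
  have Ac := conj_fun_out iso bB Ay.
  have e : conj_fun A f b (conj_fun A f b y) = conj_fun A f b y.
    by apply: bdfix; split=> //; exists x.
  have /can_inj inj := conj_funK iso bB (ta_invK b).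
  by rewrite -[in adj x y](inj _ _ e).
case: (pselect (A u)) => Au; case: (pselect (A v)) => Av.
- by rewrite /conj_fun !asboolT.
- by rewrite {1}/conj_fun asboolT// key.
- by rewrite {2}/conj_fun asboolT// adj_sym key// adj_sym.
- rewrite /conj_fun !asboolF// gadj ?ta_adj ?fadj//.
  + exact/(fixing_out bB)/fAB.
  + exact/(fixing_out bB)/fAB.
Qed.

Lemma conj_aut (h : neretin) F : finite_set F -> exists2 F', finite_set F' &
  forall b, fixing F' b -> exists2 c, fixing F c &
    (neretin_incl b * h = h * neretin_incl c)%g.
Proof.
move=> Ff; rewrite -(neretin_repr h); move: (repr h) => f.
have iso := aa_iso f; have [pA pB [fAB _ _] _] := iso.
exists (aa_cod f `|` f @` boundary (aa_dom f) `|` f @` F).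
  rewrite !finite_setU; split; last exact: finite_image.
  by split; [exact: finite_cod|exact/finite_image/finite_boundary].
move=> b bF.
have bF1 : fixing (aa_cod f `|` f @` boundary (aa_dom f)) b.
  by move=> v vF; apply: bF; left.
have bB : fixing (aa_cod f) b by move=> v vF; apply: bF1; left.
pose c := conj_fun (aa_dom f) f b.
have cb : bijective c.
  exists (conj_fun (aa_dom f) f b^-1%g).
    exact: (conj_funK iso bB (ta_invK b)).
  exact: (conj_funK iso (fixing_inv bB) (ta_Kinv b)).
have c0 : c vroot = vroot by rewrite /c /conj_fun asboolT//; case: pA.
exists (TreeAut cb c0 (fun u v => conj_fun_adj u v iso bF1)).
  move=> v Fv /=; rewrite /c /conj_fun; case: asboolP => // Av.
  by rewrite bF ?(invfK iso)//; right; exists v.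
rewrite [LHS]neretin_mulE [RHS]neretin_mulE; apply/neretin_ofP/aa_equivP.
exists (aa_dom f); first exact: finite_dom.
move=> v Av; rewrite !aa_compE /= !mkaaE /= /c /conj_fun asboolF//.
by rewrite (invfP iso _).2//; exact/(fixing_out bB)/fAB.
Qed.

Lemma neretin_mul_continuous : continuous (fun x : neretin * neretin => (x.1 * x.2)%g).
Proof.
move=> [g h] U /= /neretin_nbhsP[F Ff FU].
have [F' F'f HF'] := conj_aut h Ff.
exists ([set g * neretin_incl a | a in fixing F']%g, [set h * neretin_incl a | a in fixing F]%g).
  by split; apply/neretin_nbhsP; [exists F'|exists F] => // a aF; exists a.
move=> [_ _] [/= [b bF' <-] [a aF <-]].
have [c cF bc] := HF' b bF'.
rewrite mulgA -(mulgA g) bc !mulgA -mulgA -neretin_inclM.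
by apply: FU => v Fv /=; rewrite aF// cF.
Qed.

Lemma neretin_inv_continuous : continuous (fun x : neretin => x^-1%g).
Proof.
move=> g U /= /neretin_nbhsP[F Ff FU].
have [F' F'f HF'] := conj_aut g^-1%g Ff.
apply/neretin_nbhsP; exists F' => // b bF'.
have [c cF bc] := HF' _ (fixing_inv bF').
by rewrite /= invgM -neretin_inclV bc; exact: FU.
Qed.

HB.instance Definition _ := Group_isTopological.Build neretin
  neretin_mul_continuous neretin_inv_continuous.

Lemma ta_depth (a : tree_aut) v : depth (a v) = depth v.
Proof.
have [n] := ubnP (depth v); elim: n v => // n IHn v vn.
have [->|v0] := eqVneq v vroot; first by rewrite ta_root.
have av0 : a v != vroot by rewrite -(ta_root a) (inj_eq (bij_inj (ta_bij a))).
rewrite (depth_parent v0) (depth_parent av0); congr _.+1.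
have pvn : depth (parent v) < n by rewrite -ltnS -(depth_parent v0).
have [pv|/eqP pv] := eqVneq (parent v) vroot.
  have /(iso_bd (aa_of_iso a))[_ /(_ pv) ->] : ~ [set vroot] v by exact/eqP.
  by rewrite pv.
by rewrite -(iso_parent (aa_of_iso a)) ?IHn//=; exact/eqP.
Qed.

Lemma finite_level n : finite_set [set v : vertex | depth v = n].
Proof.
elim: n => [|n IHn].
  by apply: (sub_finite_set _ (finite_set1 vroot)) => -[[i s]|].
apply: (@sub_finite_set _ _ (\bigcup_(u in [set u : vertex | depth u = n]) [set` succs u])).
  move=> v /= dv; have v0 : v != vroot by case: (v) dv.
  exists (parent v) => /=; last by rewrite mem_succs /child v0 eqxx.
  by move: dv; rewrite depth_parent// => -[].
by apply: bigcup_finite => // u _; exact: finite_seq.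
Qed.

Lemma ultra_finite T (F : set_system T) (r : T -> vertex) (L : set vertex) :
  UltraFilter F -> finite_set L -> (forall a, L (r a)) ->
  exists w, F [set a | r a = w].
Proof.
move=> FU /finite_fsetP[D ->] rL; apply: contrapT => /forallNP H.
have : F (\bigcap_(w in [set` D]) ~` [set a | r a = w]).
  by apply: filter_bigI => w _; have [/H|] := in_ultra_setVsetC [set a | r a = w] FU.
move=> /filter_ex[a /(_ (r a) (rL a))]; exact.
Qed.

Lemma tree_aut_compact : compact [set: tree_aut].
Proof.
rewrite compact_ultra => F FU _.
have HF v : exists w, F [set a : tree_aut | a v = w].
  by apply: (ultra_finite FU (finite_level (depth v))) => a; exact: ta_depth.
have HFV v : exists w, F [set a : tree_aut | (a^-1)%g v = w].
  by apply: (ultra_finite FU (finite_level (depth v))) => a; exact: ta_depth.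
have [g gP] := boolp.choice HF; have [h hP] := boolp.choice HFV.
have gK : cancel g h.
  move=> v; have [a [/= <- <-]] := filter_ex (filterI (gP v) (hP (g v))).
  exact: ta_invK.
have hK : cancel h g.
  move=> v; have [a [/= <- <-]] := filter_ex (filterI (hP v) (gP (h v))).
  exact: ta_Kinv.
have g0 : g vroot = vroot.
  by have [a /= <-] := filter_ex (gP vroot); exact: ta_root.
have gadj u v : adj (g u) (g v) = adj u v.
  by have [a [/= <- <-]] := filter_ex (filterI (gP u) (gP v)); exact: ta_adj.
exists (TreeAut (Bijective gK hK) g0 gadj); split=> // U /ta_nbhsP[D /finite_fsetP[E ->] EU].
apply: filterS (_ : F (\bigcap_(v in [set` E]) [set a : tree_aut | a v = g v])).
  by move=> a aE; exact: EU.
by apply: filter_bigI => v _; exact: gP.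
Qed.

Lemma neretin_locally_compact : locally_compact [set: neretin].
Proof.
move=> g _; rewrite withinET.
have gN : nbhs g [set (g * neretin_incl a)%g | a in [set: tree_aut]].
  by apply/neretin_nbhsP; exists set0 => // a _; exists a.
exists [set (g * neretin_incl a)%g | a in [set: tree_aut]] => //; split.
  apply: continuous_compact; last exact: tree_aut_compact.
  apply: continuous_subspaceT => a.
  apply: (@continuous2_cvg _ _ _ _ (nbhs a) _ _ _ _ g (neretin_incl a)).
  - exact: (@mulg_continuous _ (g, neretin_incl a)).
  - exact: cvg_cst.
  - exact: neretin_incl_continuous.
rewrite -openC openE => h hN; apply/neretin_nbhsP; exists set0 => // b _ [c _ e].
apply: hN; exists (c * b^-1)%g => //.
by rewrite neretin_inclM mulgA e neretin_inclV mulgK.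
Qed.

(* The topology of a topological group structure on [neretin] (transported    *)
(* here by f) is determined by the requirement that the inclusion of the      *)
(* profinite automorphism group be continuous and open.                       *)
Lemma neretin_topology_unique (G : topologicalGroupType) (f : neretin -> G) :
  bijective f -> (forall g h : neretin, f (g * h)%g = (f g * f h)%g) ->
  continuous (f \o neretin_incl) ->
  (forall U, open U -> open ((f \o neretin_incl) @` U)) ->
  forall U : set neretin, open (f @` U) <-> open U.
Proof.
move=> fbij fM fcont fopen U; have finj := bij_inj fbij.
have Lcont x : continuous (fun y : G => (x * y)%g).
  move=> y; apply: (@continuous2_cvg _ _ _ _ (nbhs y) _ _ _ _ x y).
  - exact: (@mulg_continuous G (x, y)).
  - exact: cvg_cst.
  - exact: cvg_id.
split=> oU.
  suff : neretin_open U by [].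
  move=> g.
  have -> : [set a | U (g * neretin_incl a)%g] =
      (f \o neretin_incl) @^-1` ((fun y => f g * y)%g @^-1` (f @` U)).
    apply/seteqP; split=> a /=; first by exists (g * neretin_incl a)%g.
    by rewrite -fM => -[h Uh /finj <-].
  by move/continuousP: fcont; apply; move/continuousP: (Lcont (f g)); apply.
rewrite openE => _ [g Ug <-]; rewrite /interior nbhsE.
exists ((fun y => (f g)^-1 * y)%g @^-1`
    ((f \o neretin_incl) @` [set a | U (g * neretin_incl a)%g])).
  split; first by move/continuousP: (Lcont (f g)^-1%g); apply; exact: fopen (oU g).
  exists 1%g; rewrite /= ?neretin_incl1 ?mulg1//.
  rewrite mulVg; apply: (mulgI (f 1%g)); by rewrite -fM !mulg1.
move=> x [a /= Ua e]; exists (g * neretin_incl a)%g => //.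
by rewrite fM e mulgA mulgV mul1g.
Qed.

End Tree.

(* Main.v *)
Require Import Defs.
From mathcomp Require Import all_boot zify.
From mathcomp Require Import all_classical topology.

Set Implicit Arguments.
Unset Strict Implicit.
Unset Printing Implicit Defensive.

Local Open Scope classical_set_scope.

(** Let H be a closed subgroup.  A finite subtree has a list of leaves, the
    vertices just outside it; call such a list a code.  An element h of the
    Neretin group acts on a vertex v when it carries the subtree below v
    isomorphically onto the subtree below some vertex, and a bijection between
    two codes of equal size is realised in H when some h in H acts in this way
    on every leaf.  What h does inside the subtrees is left open, so each
    bijection defines a nonempty open set of elements.  There are finitely many
    codes of bounded size; hence, for every N, the closed subgroups realising
    all bijections between codes of size at most N form a Chabauty
    neighbourhood of the whole group ([flexible_of_tables]).  The claim is that
    for N large such an H is the whole group.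

    The heart of the proof propagates flexibility to all sizes: between any two
    codes of the same size H realises some bijection, and on every code H
    realises all 3-cycles.  Replacing a leaf a by its d children increases the
    size by d - 1.  A bijection realised before the replacement survives it, but
    permutes the d children in an uncontrolled way.  Among more than d! lifts
    two agree on the children, and dividing one by the other gives an element
    fixing the children and inducing a 3-cycle on the old leaves
    ([pigeonhole_cycle]); conjugation then yields all 3-cycles avoiding these
    children ([caret_cycles]).  A code of the new size can be moved onto one
    with two disjoint families of siblings, and the 3-cycles avoiding one or
    the other family generate the alternating group ([two_carets]).

    Only even permutations are controlled, but this is enough for density.
    Given g and a fine code on which g acts, H contains an element which acts
    on the code as g does, possibly after exchanging two siblings s and t
    ([permutation_or_swap]).  Exchanging two siblings is the restriction of an
    automorphism of the rooted tree fixing everything above, so in both cases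
    the element lies in a prescribed neighbourhood of g ([dense_of_flexible]).
    A closed dense subgroup is everything. *)

(** * Automorphisms of the regular tree of words *)

Section Words.
Variable d : nat.
Implicit Types (s t : seq 'I_d) (th : seq 'I_d -> seq 'I_d).

(** Words list the last letter first, so [behead] is the parent map.  The root
    is the only word that is its own parent, hence is fixed. *)
Definition word_aut th := bijective th /\ forall t, th (behead t) = behead (th t).

Lemma word_aut_id : word_aut id.
Proof. by split=> //; exists id. Qed.

Lemma word_aut_comp th th' : word_aut th -> word_aut th' -> word_aut (th \o th').
Proof.
by move=> [b e] [b' e']; split=> [|t]; [exact: bij_comp|rewrite /= e' e].
Qed.

Lemma word_aut_inv th : word_aut th ->
  exists th', [/\ word_aut th', cancel th th' & cancel th' th].
Proof.
move=> [[th' K K'] e]; exists th'; split=> //; split; first by exists th.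
by move=> t; apply: (can_inj K); rewrite e !K'.
Qed.

Lemma word_aut_size th t : word_aut th -> size (th t) = size t.
Proof.
move=> [b e]; have t0 : th [::] = [::].
  have := e [::]; rewrite /=; case: (th [::]) => // x s /=.
  by move/(congr1 size) => /eqP; rewrite /= -{2}[size s]addn0 -addn1 eqn_add2l.
elim: t => [|x t IH]; first by rewrite t0.
have := e (x :: t) => /=; case E : (th (x :: t)) => [|y s] /= E'.
  by have := bij_inj b (etrans E (esym t0)).
by rewrite -E' IH.
Qed.

Lemma word_aut_drop th n t : word_aut th -> th (drop n t) = drop n (th t).
Proof.
move=> h; elim: n t => [|n IH] t; first by rewrite !drop0.
by rewrite -addn1 -!drop_drop !drop1 -h.2 IH.
Qed.

(** An automorphism carries the subtree below s, the words with suffix s, onto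
    the subtree below its image, and both subtrees are copies of the tree. *)
Lemma word_aut_below th s : word_aut th -> exists2 th', word_aut th' &
  forall t, th (t ++ s) = th' t ++ th s.
Proof.
have cat_th th0 t0 s0 : word_aut th0 ->
    th0 (t0 ++ s0) = take (size t0) (th0 (t0 ++ s0)) ++ th0 s0.
  move=> h; rewrite -{1}[LHS](cat_take_drop (size t0)); congr (_ ++ _).
  by rewrite -word_aut_drop// drop_size_cat.
move=> h; have [thi [hi K Ki]] := word_aut_inv h.
exists (fun t => take (size t) (th (t ++ s))); last by move=> t; exact: cat_th.
split.
  exists (fun t => take (size t) (thi (t ++ th s))) => t.
    rewrite -cat_th// K size_takel ?take_size_cat//.
    by rewrite word_aut_size// size_cat leq_addr.
  rewrite -{3}(K s) -cat_th// Ki size_takel ?take_size_cat//.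
  by rewrite word_aut_size// size_cat leq_addr.
case=> [|x t] /=; first by rewrite !take0.
have := h.2 (x :: t ++ s); rewrite /= => ->.
by case: (th _).
Qed.

End Words.

(** * Local action on vertices *)

Section Acts.
Variables d k : nat.
Implicit Types (u v w : vertex d k) (f : almost_aut d k) (g h : neretin d k).
Local Notation vroot := (vroot d k).

(** The descendant of v reached by a word; the value at the root is junk, since
    the root may have a number of children different from d. *)
Definition ext v (t : seq 'I_d) : vertex d k :=
  if v is Some (i, s) then Some (i, t ++ s) else vroot.

Lemma ext_nil v : ext v [::] = v.
Proof. by case: v => [[]|]. Qed.

Lemma ext_cat v s t : ext (ext v s) t = ext v (t ++ s).
Proof. by case: v => [[i r]|] //=; rewrite catA. Qed.

Lemma depth_ext v t : v != vroot -> depth (ext v t) = depth v + size t.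
Proof. by case: v => [[i s]|] //= _; rewrite size_cat addSn addnC. Qed.

Lemma parent_ext v x t : v != vroot -> parent (ext v (x :: t)) = ext v t.
Proof. by case: v => [[]|]. Qed.

Lemma ext_inj v w s t : v != vroot -> size s = size t ->
  ext v s = ext w t -> v = w /\ s = t.
Proof.
case: v w => [[i r]|] // [[j r']|] // _ e [-> /eqP].
by rewrite eqseq_cat// => /andP[/eqP-> /eqP->].
Qed.

Lemma ext_injr v s t : v != vroot -> ext v s = ext v t -> s = t.
Proof.
case: v => [[i r]|] // _ /= [e].
have := congr1 size e; rewrite !size_cat => /eqP; rewrite eqn_add2r => /eqP es.
by move/eqP: e; rewrite eqseq_cat// => /andP[/eqP].
Qed.

Lemma ext_neq v t : v != vroot -> ext v t != vroot.
Proof. by case: v => [[]|]. Qed.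

Lemma succs_ext v x : v != vroot -> ext v [:: x] \in succs v.
Proof. by case: v => [[i s]|] //= _; rewrite map_f// mem_enum. Qed.

Lemma succsP v w : v != vroot -> w \in succs v -> exists x, w = ext v [:: x].
Proof. by case: v => [[i s]|] //= _ /mapP[x _ ->]; exists x. Qed.

Lemma succs_parent v w : w \in succs v -> parent w = v.
Proof. by rewrite mem_succs => /andP[_ /eqP]. Qed.

Lemma finite_depth (F : set (vertex d k)) : finite_set F ->
  exists n, forall v, F v -> depth v < n.
Proof.
move=> /finite_seqP[s ->]; exists (\max_(v <- s) depth v).+1 => v /= vs.
by rewrite ltnS; apply: leq_bigmax_seq.
Qed.

(** Finite subtrees are cofinal with balls, so almost automorphisms are
    identified as soon as they coincide on all deep vertices. *)
Lemma aa_equiv_depth f f' :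
  aa_equiv f f' <-> exists n, forall v, n <= depth v -> f v = f' v.
Proof.
split=> [/aa_equivP[F /finite_depth[n nF] e]|[n e]].
  by exists n => v nv; apply: e => /nF; rewrite ltnNge nv.
apply/aa_equivP; exists (\bigcup_(m in `I_n) [set v | depth v = m]).
  by apply: bigcup_finite => [|m _]; [exact: finite_II|exact: finite_level].
move=> v H; apply: e; rewrite leqNgt; apply/negP => vn.
by apply: H; exists (depth v).
Qed.

(** f carries the subtree below v isomorphically onto the subtree below w.
    Only deep descendants of v are tested, so that the property depends on the
    class of f alone. *)
Definition acts_by f v w := [/\ v != vroot, w != vroot &
  exists2 th, word_aut th &
  exists n, forall t : seq 'I_d, n <= size t -> f (ext v t) = ext w (th t)].

Definition acts h v w := acts_by (repr h) v w.

Lemma acts_of f v w : acts (neretin_of f) v w <-> acts_by f v w.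
Proof.
have sub f1 f2 : aa_equiv f1 f2 -> acts_by f1 v w -> acts_by f2 v w.
  move=> /aa_equiv_depth[m e] [v0 w0 [th hth [n H]]]; split=> //.
  exists th => //; exists (maxn m n) => t; rewrite geq_max => /andP[mt nt].
  by rewrite -e ?H// depth_ext// (leq_trans mt)// leq_addl.
have := neretin_ofK f.
by split; apply: sub => //; exact: aa_equiv_sym.
Qed.

Lemma actsM g h u v w : acts h u v -> acts g v w -> acts (g * h)%g u w.
Proof.
move=> [u0 v0 [th hth [n H]]] [_ w0 [th' hth' [n' H']]].
apply/acts_of; split=> //; exists (th' \o th); first exact: word_aut_comp.
exists (maxn n n') => t; rewrite geq_max => /andP[nt nt'].
by rewrite aa_compE /= H// H'// word_aut_size.
Qed.

Lemma acts1 v : v != vroot -> acts 1%g v v.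
Proof.
move=> v0; apply/acts_of; split=> //; exists id; first exact: word_aut_id.
by exists 0 => t _; rewrite aa_oneE.
Qed.

Lemma actsV h v w : acts h v w -> acts h^-1%g w v.
Proof.
move=> [v0 w0 [th hth [n H]]].
have [thi [hi K Ki]] := word_aut_inv hth.
split=> //; exists thi => //.
have e : neretin_of (aa_comp (repr h^-1%g) (repr h)) = neretin_of (aa_one d k) := mulVg h.
move: e => /neretin_ofP /aa_equiv_depth[m e]; exists (maxn m n) => t.
rewrite geq_max => /andP[mt nt].
have := e (ext v (thi t)); rewrite depth_ext// word_aut_size//.
rewrite (leq_trans mt (leq_addl _ _)) => /(_ isT).
by rewrite aa_compE aa_oneE /= H ?word_aut_size// Ki.
Qed.

Hypothesis hd : 1 < d.

Lemma long_word n : exists t : seq 'I_d, size t = n.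
Proof. by exists (nseq n (Ordinal (ltnW hd))); rewrite size_nseq. Qed.

Lemma acts_fun h v w w' : acts h v w -> acts h v w' -> w = w'.
Proof.
move=> [v0 w0 [th hth [n H]]] [_ w0' [th' hth' [n' H']]].
have [t st] := long_word (maxn n n').
have := H t; rewrite st leq_maxl H' ?st ?leq_maxr// => /(_ isT).
by move=> /(ext_inj w0')[|//]; rewrite !word_aut_size.
Qed.

Lemma acts_inj h v v' w : acts h v w -> acts h v' w -> v = v'.
Proof. by move=> /actsV a /actsV a'; exact: acts_fun a a'. Qed.

Lemma acts_neq h v w : acts h v w -> v != vroot /\ w != vroot.
Proof. by case. Qed.

Lemma acts_succs h a b v : acts h a b -> v \in succs a ->
  exists2 w, w \in succs b & acts h v w.
Proof.
move=> [a0 b0 [th hth [n H]]] /succsP[//|x ->].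
have [th' hth' e] := word_aut_below [:: x] hth.
case E : (th [:: x]) => [|y [|y' s]].
- by have := word_aut_size [:: x] hth; rewrite E.
- exists (ext b [:: y]); first exact: succs_ext.
  split; rewrite ?ext_neq//; exists th' => //; exists n => t nt.
  by rewrite !ext_cat H ?size_cat ?(leq_trans nt) ?leq_addr// e E.
- by have := word_aut_size [:: x] hth; rewrite E.
Qed.

Lemma ext_out A v t : pclosed A -> ~ A v -> ~ A (ext v t).
Proof.
move=> pA Av; have v0 := notroot pA Av.
elim: t => [|x t IH]; first by rewrite ext_nil.
by move=> At; apply: IH; rewrite -(parent_ext x)//; case: pA => _ _; apply.
Qed.

(** The induced map on words commutes with parents; it is bijective because the
    inverse isomorphism induces a map on words as well. *)
Lemma iso_below A B (f : vertex d k -> vertex d k) v : isoT A B f -> ~ A v ->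
  exists2 th, word_aut th & forall t, ~ A (ext v t) /\ f (ext v t) = ext (f v) (th t).
Proof.
have half A' B' (f' : vertex d k -> vertex d k) v' : isoT A' B' f' -> ~ A' v' ->
    exists2 th : seq 'I_d -> seq 'I_d, forall t, th (behead t) = behead (th t) &
    forall t, ~ A' (ext v' t) /\ f' (ext v' t) = ext (f' v') (th t).
  move=> iso Av; have [pA pB _ _] := iso.
  have v0 := notroot pA Av; have fv0 := notroot pB (iso_out iso Av).
  have At t : ~ A' (ext v' t) by exact: ext_out.
  pose word (u : vertex d k) := if u is Some (_, s) then s else [::].
  have key t : exists2 s, size s = size t & f' (ext v' t) = ext (f' v') s.
    elim: t => [|x t [s st e]]; first by exists [::]; rewrite ?ext_nil.
    have At' : ~ A' (parent (ext v' (x :: t))) by rewrite parent_ext.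
    have := iso_parent iso (At (x :: t)) At'; rewrite parent_ext// e.
    have := notroot pB (iso_out iso (At (x :: t))).
    case: (f' _) fv0 => [[i r]|] //; case: (f' _) => [[j r']|] //= _ _.
    case: r' => [|y r'] //= [-> <-]; exists (y :: s) => //=.
    by rewrite st.
  pose th t := take (size t) (word (f' (ext v' t))).
  have thE t : f' (ext v' t) = ext (f' v') (th t).
    have [s st e] := key t; rewrite e; congr ext.
    rewrite /th e /word; case: (f' v') fv0 => [[i r]|] //= _.
    by rewrite -st take_size_cat.
  have size_th t : size (th t) = size t.
    have [s st e] := key t; rewrite /th e /word; case: (f' v') fv0 => [[i r]|] //= _.
    by rewrite -st take_size_cat.
  exists th => //; case=> [|x t]; first by rewrite /th /= take0.
  have := iso_parent iso (At (x :: t)); rewrite parent_ext//= => /(_ (At t)).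
  rewrite !thE; have := size_th (x :: t); have := size_th t; case: (th (x :: t)) => // y s.
  move=> st [ss]; rewrite parent_ext// => /(ext_inj fv0)[|//].
  by rewrite st.
move=> iso Av; have [th e H] := half _ _ _ _ iso Av.
have [pA pB _ _] := iso.
have v0 := notroot pA Av; have fv0 := notroot pB (iso_out iso Av).
have [th' e' H'] := half _ _ _ _ (iso_inv iso) (iso_out iso Av).
exists th => //; split=> //; exists th' => t.
  have [At ft] := H t; have [_] := H' (th t).
  by rewrite -ft !(invfK iso)// => /(ext_injr v0).
have [Bt ft] := H' t; have [_] := H (th' t).
have := (invfP iso Bt).2; rewrite ft (invfK iso)// => -> /(ext_injr fv0).
by [].
Qed.

Lemma acts_out f v : ~ aa_dom f v -> acts (neretin_of f) v (f v).
Proof.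
move=> Av; have iso := aa_iso f; have [pA pB _ _] := iso.
have [th hth H] := iso_below iso Av; apply/acts_of; split.
- exact: notroot pA Av.
- exact: notroot pB (iso_out iso Av).
- by exists th => //; exists 0 => t _; case: (H t).
Qed.

End Acts.

(** * Codes: lists of leaves of finite subtrees *)

Section Codes.
Variables d k : nat.
Implicit Types (u v w : vertex d k) (A : set (vertex d k)) (L : seq (vertex d k)).
Local Notation vroot := (vroot d k).

Definition leaves A L := uniq L /\ forall v, v \in L <-> ~ A v /\ A (parent v).

Definition code L := exists2 A, pclosed A & leaves A L.

Lemma leaves_exist A : pclosed A -> exists L, leaves A L.
Proof.
move=> pA; have [s es] := (finite_seqP _).1 (finite_boundary pA).
exists (undup s); split; first exact: undup_uniq.
by move=> v; rewrite mem_undup -boundaryE// es.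
Qed.

Lemma code_perm L L' : perm_eq L L' -> code L -> code L'.
Proof.
move=> LL' [A pA [uL mL]]; exists A => //; split; first by rewrite -(perm_uniq LL').
by move=> v; rewrite -(perm_mem LL').
Qed.

Lemma code_uniq L : code L -> uniq L.
Proof. by case=> A _ []. Qed.

Lemma code_neq L v : code L -> v \in L -> v != vroot.
Proof. by case=> A pA [_ mL] /mL[Av _]; exact: notroot pA Av. Qed.

Lemma parent_neq v : v != vroot -> parent v != v.
Proof.
move=> v0; apply/eqP => e; have := depth_parent v0; rewrite e.
by move=> /eqP; rewrite -addn1 -[X in X == _]addn0 eqn_add2l.
Qed.

Lemma leaves_expand A a L : pclosed A -> leaves A (a :: L) ->
  pclosed (A `|` [set a]) /\ leaves (A `|` [set a]) (succs a ++ L).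
Proof.
move=> pA [uL mL]; have [Af A0 Ap] := pA.
have [Aa Apa] : ~ A a /\ A (parent a) by apply/mL; rewrite mem_head.
have a0 := notroot pA Aa.
split; first split.
- by rewrite finite_setU.
- by left.
- by move=> v [/Ap|->]; left.
have mem v : v \in succs a ++ L <-> ~ (A `|` [set a]) v /\ (A `|` [set a]) (parent v).
  rewrite mem_cat mem_succs /child; split.
    case/orP => [/andP[v0 /eqP e]|vL].
      split; last by right.
      move=> [/Ap|va]; first by rewrite e.
      by have := parent_neq v0; rewrite e va eqxx.
    have /mL[Av Apv] : v \in a :: L by rewrite inE vL orbT.
    split; last by left.
    by move=> [//|va]; move: uL; rewrite /= -va vL.
  move=> [/not_orP[Av /eqP va] [Apv|->]]; last first.
    by rewrite eqxx (notroot pA Av).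
  by have := (mL v).2 (conj Av Apv); rewrite inE (negPf va) => /= ->; rewrite orbT.
split=> //; move: uL; rewrite cat_uniq uniq_succs cons_uniq => /andP[aL ->]; rewrite andbT.
apply/hasPn => v vL; apply/negP => va.
have /mL[_] : v \in a :: L by rewrite inE vL orbT.
by rewrite (succs_parent va).
Qed.

Lemma code_expand a L : code (a :: L) -> code (succs a ++ L).
Proof. by case=> A pA /(leaves_expand pA)[]; exists (A `|` [set a]). Qed.

Lemma code_swap (a b : vertex d k) L : code [:: a, b & L] -> code [:: b, a & L].
Proof.
apply: code_perm; rewrite -[[:: a, b & L]]/([:: a; b] ++ L).
by rewrite -[[:: b, a & L]]/([:: b; a] ++ L) perm_cat2r (perm_catC [:: a]).
Qed.

Lemma code_expand_first (a b : vertex d k) L :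
  code [:: a, b & L] -> code (b :: succs a ++ L).
Proof.
by move=> /code_expand; apply: code_perm; rewrite -cat1s perm_catCA cat1s.
Qed.

(** The children of a deepest inner vertex are all leaves; collapsing them
    is possible unless the only inner vertex is the root. *)
Lemma code_contract L : code L -> perm_eq L (succs vroot) \/
  exists a L1, code (a :: L1) /\ perm_eq L (succs a ++ L1).
Proof.
move=> [A pA [uL mL]]; have [Af A0 Ap] := pA.
have [m [a Aa da] [Hm _]] : exists2 m, (exists2 a, A a & depth a = m) &
    (forall a, A a -> depth a <= m) /\ True.
  pose P m := `[< exists2 a, A a & depth a = m >].
  have exP : exists m, P m by exists 0; apply/asboolP; exists vroot.
  have [n nA] := finite_depth Af.
  have bP m : P m -> m <= n by move=> /asboolP[a /nA an <-]; exact: ltnW.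
  case: (ex_maxnP exP bP) => m /asboolP Pm Hm; exists m => //; split=> // a Aa.
  by apply: Hm; apply/asboolP; exists a.
have sub v : v \in succs a -> v \in L.
  rewrite mem_succs => va; have := va => /andP[v0 /eqP e]; apply/mL; rewrite e.
  by split=> // /Hm; rewrite (depth_child va) da ltnn.
have [ea|a0] := eqVneq a vroot.
  left; rewrite -ea; apply: uniq_perm => //; first exact: uniq_succs.
  move=> v; apply/idP/idP => [/mL[Av Apv]|/sub//].
  rewrite mem_succs /child (notroot pA Av) ea /=.
  by have := Hm _ Apv; rewrite -da ea /=; case: (parent v) => [[]|].
right; exists a, [seq v <- L | v \notin succs a].
have aL v : v \in succs a ++ [seq v <- L | v \notin succs a] = (v \in L).
  rewrite mem_cat mem_filter; case: (boolP (v \in succs a)) => //= /sub.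
  by move=> ->.
split; last first.
  apply: uniq_perm => //.
  rewrite cat_uniq uniq_succs filter_uniq// andbT; apply/hasPn => v.
  by rewrite mem_filter => /andP[].
exists (A `\` [set a]); first split.
- exact: finite_setD.
- by split=> // /eqP; rewrite eq_sym (negPf a0).
- move=> v [Av va]; split; first exact: Ap.
  move=> /= e; have v0 : v != vroot.
    by apply: contra_neq a0 => v0; move: e; rewrite v0 /= => <-.
  by have := Hm _ Av; rewrite (depth_parent v0) e da ltnn.
split.
  rewrite /= filter_uniq// andbT mem_filter negb_and; apply/orP; right.
  by apply/negP => /mL[].
move=> v; rewrite inE mem_filter; split.
  case/orP => [/eqP->|/andP[vs /mL[Av Apv]]].
    split; first by move=> [_ /(_ erefl)].
    by split; [exact: Ap|move=> /= e; have := parent_neq a0; rewrite e eqxx].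
  split; first by move=> [].
  split=> // e; move: vs; rewrite mem_succs /child e eqxx andbT.
  by rewrite (notroot pA Av).
move=> [nv [Apv pva]]; have [//|va] := eqVneq v a.
have Av : ~ A v by move=> Av; apply: nv; split=> //; exact/eqP.
rewrite /= (mL v).2// andbT mem_succs /child negb_and; apply/orP; right.
exact/eqP.
Qed.

Lemma leaf_below A L u : pclosed A -> leaves A L -> ~ A u ->
  exists2 v, v \in L & exists t, u = ext v t.
Proof.
move=> pA [_ mL]; have [n] := ubnP (depth u); elim: n u => // n IH u un Au.
have u0 := notroot pA Au.
have [Apu|Apu] := pselect (A (parent u)).
  by exists u; [exact/mL|exists [::]; rewrite ext_nil].
have [|v vL [t e]] := IH (parent u) _ Apu.
  by move: un; rewrite ltnS (depth_parent u0).
exists v => //.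
have /succsP : u \in succs (parent u) by rewrite mem_succs /child u0 eqxx.
by move=> /(_ (notroot pA Apu))[x ->]; exists (x :: t); rewrite e ext_cat.
Qed.

(** Otherwise one of the two leaves would be a strict descendant of the other,
    whose strict ascendants are inner vertices. *)
Lemma leaf_unique A L v v' s t : pclosed A -> leaves A L -> v \in L -> v' \in L ->
  ext v s = ext v' t -> v = v' /\ s = t.
Proof.
move=> pA [_ mL]; wlog st : v v' s t / size s <= size t => [H|].
  have /orP[st|ts] := leq_total (size s) (size t); first exact: H.
  by move=> vL v'L /esym e; have [-> ->] := H _ _ _ _ ts v'L vL e.
move=> /mL[Av Apv] /mL[Av' Apv'] e.
have v0 := notroot pA Av; have v0' := notroot pA Av'.
move: e; rewrite -[X in ext v' X](cat_take_drop (size s) t) -ext_cat.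
move=> /(ext_inj v0)[|ev est]; first by rewrite size_takel.
case E : (drop (size s) t) ev => [|x r] ev.
  rewrite ext_nil in ev.
  by split; rewrite ?ev// est -[RHS](cat_take_drop (size s)) E cats0.
by move: Apv; rewrite ev parent_ext// => /(ext_out pA Av').
Qed.

(** Outside a finite subtree the forest is the disjoint union of the subtrees
    below its leaves, so isomorphisms below the leaves can be chosen
    independently. *)
Lemma glue_iso A A' L L' (phi : vertex d k -> vertex d k)
    (th : vertex d k -> seq 'I_d -> seq 'I_d) :
  pclosed A -> pclosed A' -> leaves A L -> leaves A' L' ->
  size L = size L' -> {in L, forall v, phi v \in L'} -> {in L &, injective phi} ->
  {in L, forall v, word_aut (th v)} ->
  exists2 f, isoT A A' f &
    {in L, forall v t, f (ext v t) = ext (phi v) (th v t)}.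
Proof.
move=> pA pA' lA lA' sLL' phiL' phi_inj hth.
have [uL mL] := lA; have [uL' mL'] := lA'.
have phi_surj w : w \in L' -> exists2 v, v \in L & w = phi v.
  have um : uniq (map phi L) by rewrite map_inj_in_uniq.
  have sub : {subset map phi L <= L'} by move=> _ /mapP[v vL ->]; exact: phiL'.
  have [|_ e] := uniq_min_size um sub; first by rewrite size_map sLL'.
  by rewrite -e => /mapP.
have /boolp.choice[f fE] : forall u, exists w, forall v t, v \in L -> u = ext v t ->
    w = ext (phi v) (th v t).
  move=> u; have [[v vL [t ->]]|H] := pselect (exists2 v, v \in L & exists t, u = ext v t).
    by exists (ext (phi v) (th v t)) => v' t' v'L /(leaf_unique pA lA vL v'L)[-> ->].
  by exists vroot => v t vL e; case: H; exists v => //; exists t.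
have fL : {in L, forall v t, f (ext v t) = ext (phi v) (th v t)}.
  by move=> v vL t; exact: fE.
have fleaf v : v \in L -> f v = phi v.
  move=> vL; rewrite -{1}(ext_nil v) fL//.
  have := word_aut_size [::] (hth _ vL); case: (th v _) => // _; exact: ext_nil.
have fout u : ~ A u -> ~ A' (f u).
  move=> /(leaf_below pA lA)[v vL [t ->]]; rewrite fL//; apply: ext_out => //.
  by have [] := (mL' _).1 (phiL' _ vL).
have fpar u : ~ A u -> ~ A (parent u) -> f (parent u) = parent (f u).
  move=> /(leaf_below pA lA)[v vL [[|x t] ->]].
    by rewrite ext_nil; have [] := (mL _).1 vL.
  rewrite parent_ext ?(notroot pA ((mL _).1 vL).1)// !fL// => _.
  have := (hth _ vL).2 (x :: t); rewrite /= => ->.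
  have := word_aut_size (x :: t) (hth _ vL); case: (th v _) => // y s _.
  by rewrite parent_ext// (notroot pA' ((mL' _).1 (phiL' _ vL)).1).
have fbd u : ~ A u -> A (parent u) -> A' (parent (f u)).
  move=> Au Apu; have uL0 : u \in L by exact/mL.
  by rewrite fleaf//; have [] := (mL' _).1 (phiL' _ uL0).
have fi u v : ~ A u -> ~ A v -> f u = f v -> u = v.
  move=> /(leaf_below pA lA)[a aL [s ->]] /(leaf_below pA lA)[b bL [t ->]].
  rewrite !fL// => /(leaf_unique pA' lA' (phiL' _ aL) (phiL' _ bL))[/phi_inj ab].
  by move: ab => /(_ aL bL) <-; move=> /(bij_inj (hth _ aL).1) ->.
exists f => //; split=> //.
  split=> [u Au|u v|w]; first exact: fout.
    by rewrite !inE; exact: fi.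
  move=> /(leaf_below pA' lA')[w' /phi_surj[v vL ->] [t ->]].
  have [[thi K Ki] _] := hth _ vL; exists (ext v (thi t)).
    by apply: ext_out => //; have [] := (mL _).1 vL.
  by rewrite fL// Ki.
have fchild u v : ~ A u -> ~ A v -> child (f u) (f v) = child u v.
  move=> Au Av; rewrite /child (notroot pA Av) (notroot pA' (fout _ Av)) /=.
  apply/eqP/eqP => [e|e]; last by rewrite -fpar ?e.
  have [Apv|Apv] := pselect (A (parent v)).
    by have := fbd _ Av Apv; rewrite e => /(fout _ Au).
  by apply: fi => //; rewrite fpar.
by move=> u v Au Av; rewrite /adj !fchild.
Qed.

Lemma table_exists L L' (phi : vertex d k -> vertex d k) : code L -> code L' ->
  size L = size L' -> {in L, forall v, phi v \in L'} -> {in L &, injective phi} ->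
  exists h : neretin d k, {in L, forall v, acts h v (phi v)}.
Proof.
move=> cL cL' sLL' phiL phi_inj; have [A pA lA] := cL; have [A' pA' lA'] := cL'.
have [|f iso fL] := @glue_iso A A' L L' phi (fun _ => id) pA pA' lA lA' sLL' phiL phi_inj.
  by move=> v _; exact: word_aut_id.
exists (neretin_of (mkaa iso)) => v vL; apply/acts_of; split.
- exact: code_neq cL vL.
- exact: code_neq cL' (phiL _ vL).
- by exists id; [exact: word_aut_id|exists 0 => t _; rewrite mkaaE fL].
Qed.

Lemma code_image (f : almost_aut d k) A L : pclosed A -> leaves A L ->
  aa_dom f `<=` A -> code (map f L).
Proof.
move=> pA lA fA; have iso := aa_iso f; have [_ _ [fB fi fs] fadj] := iso.
have [uL mL] := lA.
have out v : v \in L -> ~ aa_dom f v by move=> /mL[Av _] /fA.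
exists (aa_cod f `|` f @` (A `\` aa_dom f)); first exact: iso_img.
have notin u : ~ A u -> ~ (aa_cod f `|` f @` (A `\` aa_dom f)) (f u).
  move=> Au; have fu : ~ aa_dom f u by move=> /fA.
  case=> [|[u' [Au' fu'] e]]; first exact: fB.
  by apply: Au; rewrite -(iso_inj iso fu' fu e).
have isin u : ~ A u -> A (parent u) <->
    (aa_cod f `|` f @` (A `\` aa_dom f)) (parent (f u)).
  move=> Au; have fu : ~ aa_dom f u by move=> /fA.
  have [dpu|dpu] := pselect (aa_dom f (parent u)).
    by split=> _; [left; exact/(iso_bd iso fu)|exact: fA].
  rewrite -(iso_parent iso)//; split=> [Apu|]; first by right; exists (parent u).
  by apply: contraPP => /notin.
split.
  rewrite map_inj_in_uniq// => u v /out uA /out vA; exact: iso_inj iso _ _.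
move=> w; split=> [/mapP[v vL ->]|[nw nwp]].
  by have [Av Apv] := (mL _).1 vL; split; [exact: notin|exact/isin].
have /fs[v dv e] : ~ aa_cod f w by move=> ?; apply: nw; left.
have Av : ~ A v by move=> Av; apply: nw; right; exists v.
by subst w; apply: map_f; apply/mL; split=> //; exact/isin.
Qed.

(** A permutation of the leaves that preserves parents extends by the identity
    over the finite subtree. *)
Lemma tree_aut_of_siblings A L (phi : vertex d k -> vertex d k) (x : neretin d k) :
  pclosed A -> leaves A L -> {in L, forall v, phi v \in L} -> {in L &, injective phi} ->
  {in L, forall v, parent (phi v) = parent v} -> {in L, forall v, acts x v (phi v)} ->
  exists2 b : tree_aut d k, fixing A b & x = neretin_incl b.
Proof.
move=> pA lA phiL phi_inj phip xphi; have [uL mL] := lA; have [_ A0 Ap] := pA.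
have /boolp.choice[thn thnP] : forall v, exists thn : (seq 'I_d -> seq 'I_d) * nat,
    v \in L -> word_aut thn.1 /\
    forall t : seq 'I_d, thn.2 <= size t -> repr x (ext v t) = ext (phi v) (thn.1 t).
  move=> v; have [/xphi[_ _ [th hth [n H]]]|_] := boolP (v \in L).
    by exists (th, n).
  by exists (id, 0).
have [|f iso fL] := @glue_iso A A L L phi (fun v => (thn v).1) pA pA lA lA erefl phiL phi_inj.
  by move=> v /thnP[].
have [_ _ [fA fi fs] fadj] := iso.
pose b u := if `[< A u >] then u else f u.
have b0 : b vroot = vroot by rewrite /b asboolT.
have bb : bijective b.
  exists (fun u => if `[< A u >] then u else invf A f u) => u; rewrite /b.
    case: (asboolP (A u)) => Au; first by rewrite asboolT.
    by rewrite asboolF ?(invfK iso)//; exact: fA.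
  case: (asboolP (A u)) => Au; first by rewrite asboolT.
  by have [Aiu e] := invfP iso Au; rewrite asboolF.
have badj u v : adj (b u) (b v) = adj u v.
  have key u' v' : A u' -> ~ A v' -> adj u' (f v') = adj u' v'.
    move=> Au Av.
    have adjE w : ~ A w -> adj u' w = (parent w == u').
      move=> Aw; rewrite /adj /child (notroot pA Aw) /=.
      case: eqVneq => //= _; apply/negP => /andP[_ /eqP e].
      by apply: Aw; rewrite -e; exact: Ap.
    have Afv := fA _ Av; rewrite !adjE//.
    have [Apv|Apv] := pselect (A (parent v')).
      have vL : v' \in L by exact/mL.
      rewrite -{1}(ext_nil v') fL// -[in RHS](phip _ vL).
      have := word_aut_size [::] (thnP _ vL).1; case: (thn v').1 => // _.
      by rewrite ext_nil.
    have Apfv : ~ A (parent (f v')) by move=> /(iso_bd iso Av).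
    by apply/eqP/eqP => e; subst u'.
  rewrite /b; case: (asboolP (A u)) => Au; case: (asboolP (A v)) => Av //.
  - exact: key.
  - by rewrite adj_sym key// adj_sym.
  - exact: fadj.
exists (TreeAut bb b0 badj); first by move=> v Av; rewrite /= /b asboolT.
rewrite -(neretin_repr x); apply/neretin_ofP/aa_equiv_depth.
have [n nA] := finite_depth (let: And3 Af _ _ := pA in Af).
exists (n + \max_(v <- L) (depth v + (thn v).2)) => u nu.
have Au : ~ A u by move=> /nA; rewrite ltnNge (leq_trans _ nu)// leq_addr.
rewrite mkaaE /= /b asboolF//.
have [v vL [t ut]] := leaf_below pA lA Au; rewrite ut fL// (thnP _ vL).2//.
have v0 : v != vroot by exact: notroot pA ((mL v).1 vL).1.
have : depth v + (thn v).2 <= depth u.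
  apply: leq_trans nu; apply: leq_trans (leq_addl n _).
  exact: (@leq_bigmax_seq _ L xpredT (fun v => depth v + (thn v).2)).
by rewrite ut depth_ext// leq_add2l.
Qed.

End Codes.

(** * Generating 3-cycles *)

Lemma fresh (T : eqType) (S s : seq T) : uniq S -> size s < size S ->
  exists2 q, q \in S & q \notin s.
Proof.
move=> uS sS; apply: contrapT => /forall2NP H.
have : {subset S <= s} by move=> q qS; have [/(_ qS)//|/negP/negPn] := H q.
by move=> /(uniq_leq_size uS); rewrite leqNgt sS.
Qed.

Lemma mem_catl (T : eqType) (s1 s2 : seq T) x : x \in s1 -> x \in s1 ++ s2.
Proof. by rewrite mem_cat => ->. Qed.

Lemma mem_catr (T : eqType) (s1 s2 : seq T) x : x \in s2 -> x \in s1 ++ s2.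
Proof. by rewrite mem_cat => ->; rewrite orbT. Qed.

(* These two tactics prove the distinctness of some points from conjunctions of
   disequalities in the context. *)
Ltac split_neq := repeat match goal with
  | H : is_true (_ && _) |- _ => let H1 := fresh in let H2 := fresh in
      move/andP: H => [H1 H2] end.
Ltac distinct := rewrite /= ?inE ?negb_or; repeat (apply/andP; split);
  by [|rewrite eq_sym].

(** The combinatorics shared by both generation steps.  C is meant to hold of a
    triple when its 3-cycle is available, and S is a large set of harmless
    points: a point of a triple may be replaced by another one as soon as one
    of the two is harmless.  The route from (u, v, w) to (x, y, z) goes through
    three harmless points distinct from all six. *)
Lemma triples_connected (T : eqType) (C : T -> T -> T -> Prop) (S X : seq T) :
  uniq S -> 9 <= size S -> {subset S <= X} ->
  (forall x y z, C x y z -> C y z x) ->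
  (forall x y z p, [&& x \in X, y \in X, z \in X & p \in X] -> uniq [:: x; y; z; p] ->
     (z \in S) || (p \in S) -> C x y z -> C x y p) ->
  forall u v w x y z, [&& u \in X, v \in X & w \in X] -> uniq [:: u; v; w] ->
  [&& x \in X, y \in X & z \in X] -> uniq [:: x; y; z] -> C u v w -> C x y z.
Proof.
move=> uS sS SX rot repl u v w x y z /and3P[uX vX wX] U /and3P[xX yX zX] V Cuvw.
have [|p pS pn] := @fresh _ _ [:: u; v; w; x; y; z] uS; first exact: leq_trans sS.
have [|q qS qn] := @fresh _ _ [:: p; u; v; w; x; y; z] uS; first exact: leq_trans sS.
have [|r rS rn] := @fresh _ _ [:: q; p; u; v; w; x; y; z] uS; first exact: leq_trans sS.
have [pX qX rX] := And3 (SX _ pS) (SX _ qS) (SX _ rS).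
move: U V pn qn rn; rewrite /= !inE !negb_or => U V pn qn rn; split_neq.
have C1 : C u v p by apply: (repl _ _ w); rewrite ?pS ?orbT ?uX ?vX ?wX ?pX//; distinct.
have C2 : C v p q.
  by apply: (repl _ _ u); rewrite ?qS ?orbT ?vX ?pX ?uX ?qX//; [distinct|exact/rot/rot/rot/rot].
have C3 : C p q r.
  by apply: (repl _ _ v); rewrite ?rS ?orbT ?vX ?pX ?qX ?rX//; [distinct|exact/rot].
have C4 : C p q x by apply: (repl _ _ r); rewrite ?rS ?pX ?qX ?rX ?xX//; distinct.
have C5 : C q x y by apply: (repl _ _ p); rewrite ?pS ?pX ?qX ?xX ?yX//; [distinct|exact/rot].
by apply: (repl _ _ q); rewrite ?qS ?qX ?xX ?yX ?zX//; [distinct|exact/rot].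
Qed.

(** * Propagating flexibility to larger codes *)

Section Engine.
Variables d k : nat.
Hypothesis hd : 1 < d.
Implicit Types (u v w x y z : vertex d k) (L R : seq (vertex d k)) (g h c : neretin d k).
Local Notation vroot := (vroot d k).

Definition cycles h L x y z := [/\ acts h x y, acts h y z, acts h z x &
  forall v, v \in L -> v \notin [:: x; y; z] -> acts h v v].

Definition maps h L L' := forall v, v \in L -> exists2 w, w \in L' & acts h v w.

(** The image of a vertex determines the vertex, so this is a counting
    argument. *)
Lemma maps_onto h L L' : uniq L -> size L = size L' -> maps h L L' ->
  forall w, w \in L' -> exists2 v, v \in L & acts h v w.
Proof.
move=> uL sLL' hLL'.
have /boolp.choice[m mP] : forall v, exists w, v \in L -> w \in L' /\ acts h v w.
  move=> v; have [/hLL'[w wL' hw]|_] := boolP (v \in L); first by exists w.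
  by exists v.
have um : uniq (map m L).
  rewrite map_inj_in_uniq// => u v /mP[_ hu] /mP[_ hv] e.
  by rewrite e in hu; exact (acts_inj hd hu hv).
have sub : {subset map m L <= L'} by move=> _ /mapP[v /mP[vL' _] ->].
have [|_ e] := uniq_min_size um sub; first by rewrite size_map sLL'.
by move=> w; rewrite -e => /mapP[v vL ->]; exists v => //; case: (mP _ vL).
Qed.

Lemma cycles_maps h L x y z : x \in L -> y \in L -> z \in L ->
  cycles h L x y z -> maps h L L.
Proof.
move=> xL yL zL [xy yz zx fix_h] v vL.
have [->|vx] := eqVneq v x; first by exists y.
have [->|vy] := eqVneq v y; first by exists z.
have [->|vz] := eqVneq v z; first by exists x.
by exists v => //; apply: fix_h; rewrite // !inE !negb_or vx vy.
Qed.

Lemma maps_expand h a a' L L' : acts h a a' -> maps h L L' ->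
  maps h (succs a ++ L) (succs a' ++ L').
Proof.
move=> haa' hLL' v; rewrite mem_cat => /orP[/(acts_succs haa')|/hLL'] [w wL vw];
by exists w; rewrite // mem_cat wL ?orbT.
Qed.

Lemma maps_sub h L L' M M' : {subset M <= L} -> {subset L' <= M'} ->
  maps h L L' -> maps h M M'.
Proof. by move=> ML LM hLL' v /ML /hLL'[w /LM wM vw]; exists w. Qed.

Variable H : set (neretin d k).
Hypothesis HM : forall g h, H g -> H h -> H (g * h)%g.
Hypothesis HV : forall g, H g -> H g^-1%g.

Definition has_cycle L x y z := exists2 h, H h & cycles h L x y z.

Definition has_map L L' := exists2 h, H h & maps h L L'.

Definition all_cycles L := forall x y z, x \in L -> y \in L -> z \in L ->
  uniq [:: x; y; z] -> has_cycle L x y z.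

Lemma has_cycle_rot L x y z : has_cycle L x y z -> has_cycle L y z x.
Proof.
move=> [h Hh [xy yz zx fix_h]]; exists h => //; split=> // v vL.
by rewrite -(mem_rot 2) => /fix_h; exact.
Qed.

Lemma has_cycle_sub L L' x y z : {subset L' <= L} -> has_cycle L x y z -> has_cycle L' x y z.
Proof.
by move=> LL' [h Hh [xy yz zx fix_h]]; exists h => //; split=> // v /LL'/fix_h.
Qed.

(** c need not preserve the 3-cycle or the list; this both transports 3-cycles
    between codes and produces new ones on the same code. *)
Lemma has_cycle_conj c L L' x y z x' y' z' : H c ->
  acts c x x' -> acts c y y' -> acts c z z' ->
  (forall v, v \in L' -> exists2 w, w \in L & acts c w v) ->
  has_cycle L x y z -> has_cycle L' x' y' z'.
Proof.
move=> Hc xx yy zz onto [h Hh [xy yz zx fix_h]].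
exists (c * (h * c^-1))%g; first by apply: (HM Hc); apply: HM => //; exact: HV.
have conj u v u' v' : acts c u u' -> acts h u v -> acts c v v' ->
    acts (c * (h * c^-1))%g u' v'.
  by move=> uu uv vv; apply: actsM vv; apply: actsM uv; exact: actsV.
split; [exact: conj xx xy yy|exact: conj yy yz zz|exact: conj zz zx xx|].
move=> v /onto[w wL wv] vn; apply: (conj _ _ _ _ wv _ wv); apply: fix_h => //.
move: vn; rewrite !inE; apply: contra => /or3P[] /eqP e; subst w.
- by rewrite (acts_fun hd wv xx) eqxx.
- by rewrite (acts_fun hd wv yy) eqxx orbT.
- by rewrite (acts_fun hd wv zz) eqxx !orbT.
Qed.

(** Fix y and z.  For every other x of L the 3-cycle (x y z) has a lift in H
    which permutes the d children of a.  More than d! such lifts cannot all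
    induce different permutations; if those of x1 and x2 agree, the quotient
    fixes the children, and (x2 y z)^-1 (x1 y z) = (x1 x2 z). *)
Lemma pigeonhole_cycle a L : code (a :: L) -> all_cycles (a :: L) ->
  d`!.+2 < size L ->
  exists x y z, [/\ x \in L, y \in L, z \in L, uniq [:: x; y; z] &
                    has_cycle (succs a ++ L) x y z].
Proof.
case: L => [|y [|z X]] //; rewrite /= => cL TL.
rewrite !ltnS => sX.
have := code_uniq cL; rewrite /= !inE !negb_or.
move=> /and4P[/and3P[ay az aX] /andP[yz yX] zX uX].
have a0 := code_neq cL (mem_head _ _).
have neq x : x \in X -> [/\ x != y, x != z & x != a].
  move=> xX; split.
  - by apply: contraNneq yX => <-; rewrite xX.
  - by apply: contraNneq zX => <-; rewrite xX.
  - by apply: contraNneq aX => <-; rewrite xX.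
have /boolp.choice[F FP] : forall x, exists F : neretin d k * (vertex d k -> vertex d k),
   x \in X -> [/\ H F.1, cycles F.1 [:: a, y, z & X] x y z &
    forall v, v \in succs a -> F.2 v \in succs a /\ acts F.1 v (F.2 v)].
  move=> x; have [xX|_] := boolP (x \in X); last by exists (1%g, id).
  have [xy xz xa] := neq _ xX.
  have [|||| h Hh hx] := TL x y z; rewrite ?inE ?eqxx ?xX ?orbT//.
    by distinct.
  have haa : acts h a a.
    case: hx => _ _ _; apply; rewrite ?mem_head// !inE !negb_or eq_sym xa /=.
    by apply/andP.
  have /boolp.choice[m mP] : forall v, exists w, v \in succs a -> w \in succs a /\ acts h v w.
    move=> v; have [/(acts_succs haa)[w wL hw]|_] := boolP (v \in succs a).
      by exists w.
    by exists v.
  by exists (h, m).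
pose sg x := map (F x).2 (succs a).
have [x1 [x2 [x1X x2X x12 sg12]]] : exists x1 x2, [/\ x1 \in X, x2 \in X,
    x1 != x2 & sg x1 = sg x2].
  apply: contrapT => Hn.
  have us : uniq (map sg X).
    rewrite map_inj_in_uniq// => x1 x2 x1X x2X e; apply/eqP.
    by apply: contra_notT Hn => x12; exists x1, x2.
  have sub : {subset map sg X <= permutations (succs a)}.
    move=> _ /mapP[x xX ->]; rewrite mem_permutations.
    have [_ _ mP] := FP _ xX.
    have um : uniq (sg x).
      rewrite map_inj_in_uniq ?uniq_succs// => u v /mP[_ hu] /mP[_ hv] e.
      by rewrite e in hu; exact (acts_inj hd hu hv).
    have ss : {subset sg x <= succs a} by move=> _ /mapP[v /mP[vL' _] ->].
    apply: uniq_perm => //; first exact: uniq_succs.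
    by have [|_ e] := uniq_min_size um ss; rewrite ?size_map.
  have := uniq_leq_size us sub.
  by rewrite size_map size_permutations ?uniq_succs// size_succs// leqNgt sX.
have [Hh1 [c1 c1' c1'' f1] m1] := FP _ x1X.
have [Hh2 [c2 c2' c2'' f2] m2] := FP _ x2X.
have [x1y x1z x1a] := neq _ x1X; have [x2y x2z x2a] := neq _ x2X.
exists x1, x2, z; rewrite !inE x1X x2X eqxx !orbT; split=> //; first by distinct.
exists ((F x2).1^-1 * (F x1).1)%g; first by apply: HM => //; exact: HV.
split.
- by apply: actsM c1 _; exact: actsV.
- apply: actsM (_ : acts _ x2 x2) _; last exact: actsV.
  by apply: f1; [rewrite !inE x2X !orbT|distinct].
- apply: actsM c1'' _; apply: actsV; apply: f2; first by rewrite !inE x1X !orbT.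
  by distinct.
move=> v; rewrite mem_cat => /orP[va _|vL].
  have [_ a1] := m1 _ va; have [_ a2] := m2 _ va.
  apply: actsM a1 _; apply: actsV.
  by have /eq_in_map -> := sg12.
rewrite !inE !negb_or => /and3P[vx1 vx2 vz].
have [->|vy] := eqVneq v y; first by apply: actsM c1' _; exact: actsV.
have vL' : v \in [:: a, y, z & X] by rewrite inE vL orbT.
apply: actsM (_ : acts _ v v) _; first by apply: f1 => //; distinct.
by apply: actsV; apply: f2 => //; distinct.
Qed.

(** Replacing a point z of a 3-cycle by p amounts to a conjugation by (z p q),
    whose lift preserves the set of children of a although it may permute
    them. *)
Lemma caret_cycles a L : code (a :: L) -> all_cycles (a :: L) ->
  d`! + 9 < size L ->
  forall x y z, x \in L -> y \in L -> z \in L -> uniq [:: x; y; z] ->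
  has_cycle (succs a ++ L) x y z.
Proof.
move=> cL TL sL x y z xL yL zL uxyz.
have [|u [v [w [uL vL wL uuvw Cuvw]]]] := pigeonhole_cycle cL TL.
  by apply: leq_trans sL; rewrite -addn2 ltnS leq_add2l.
have /andP[aL uniqL] : (a \notin L) && uniq L := code_uniq cL.
have s9 : 9 <= size L by apply: leq_trans sL; apply: ltnW; rewrite ltnS leq_addl.
apply: (triples_connected (S := L) (X := L) (C := has_cycle (succs a ++ L)) uniqL s9
   _ _ _ _ uuvw _ uxyz Cuvw) => //; rewrite ?uL ?vL ?xL ?yL//.
  by move=> *; exact: has_cycle_rot.
move=> {u v w uL vL wL uuvw Cuvw x y z xL yL zL uxyz} x y z p.
move=> /and4P[xL yL zL pL] uxyzp _.
have [|q qL qn] := @fresh _ _ [:: x; y; z; p] uniqL; first exact: leq_trans s9.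
have neq v : v \in L -> a != v by move=> vL; apply: contraNneq aL => ->.
have [ax [ay [az ap]]] := (neq _ xL, (neq _ yL, (neq _ zL, neq _ pL))).
have aq := neq _ qL.
move: uxyzp qn; rewrite /= !inE !negb_or => U V; split_neq.
have [| | | |c Hc hc] := TL z p q; rewrite ?inE ?zL ?pL ?qL ?orbT//.
  by distinct.
have [zp pq qz fc] := hc.
have fcL v : v \in L -> v != z -> v != p -> v != q -> acts c v v.
  by move=> vL *; apply: fc; [rewrite inE vL orbT|distinct].
have caa : acts c a a by apply: fc; [exact: mem_head|distinct].
apply: (has_cycle_conj (L := succs a ++ L) Hc _ _ zp).
- by apply: fcL => //; rewrite // eq_sym.
- by apply: fcL => //; rewrite // eq_sym.
move=> v; rewrite mem_cat => /orP[va|vL].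
  have [w wa vw] := acts_succs (actsV caa) va.
  by exists w; [exact: mem_catl|rewrite -(invgK c); exact: actsV].
have [->|vz] := eqVneq v z; first by exists q => //; exact: mem_catr.
have [->|vp] := eqVneq v p; first by exists z => //; exact: mem_catr.
have [->|vq] := eqVneq v q; first by exists p => //; exact: mem_catr.
by exists v; [exact: mem_catr|exact: fcL].
Qed.

(** The 3-cycles avoiding the children of b, or avoiding those of c, are
    available.  Two points belong to a common 3-cycle of this kind as soon as
    one of them lies in R. *)
Lemma two_carets (b c : vertex d k) R : code [:: b, c & R] ->
  all_cycles (b :: succs c ++ R) -> all_cycles (c :: succs b ++ R) ->
  d`! + 9 < size R -> all_cycles (succs b ++ succs c ++ R).
Proof.
move=> cL Tc Tb sR.
have cc := code_expand_first (code_swap cL); have cb := code_expand_first cL.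
have sR' e : d`! + 9 < size (succs e ++ R).
  by apply: leq_trans sR _; rewrite size_cat leq_addl.
have Cc := caret_cycles cc Tc (sR' c); have Cb := caret_cycles cb Tb (sR' b).
set L := succs b ++ succs c ++ R in Cc *.
have LE : L =i succs c ++ succs b ++ R by move=> v; rewrite !mem_cat orbCA.
have {}Cb x y z : x \in succs b ++ R -> y \in succs b ++ R -> z \in succs b ++ R ->
    uniq [:: x; y; z] -> has_cycle L x y z.
  by move=> *; apply: has_cycle_sub (Cb _ _ _ _ _ _ _) => // v; rewrite LE.
have RL : {subset R <= L} by move=> v vR; rewrite !mem_cat vR !orbT.
have [uR uL] : uniq R /\ uniq L.
  have uL := code_uniq (code_expand cc).
  by split=> //; move: uL; rewrite /L !cat_uniq => /and3P[_ _ /and3P[]].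
have s9 : 9 <= size R by apply: leq_trans sR; apply: ltnW; rewrite ltnS leq_addl.
have [|u uR1 _] := @fresh _ _ [::] uR; first exact: leq_trans s9.
have [|v vR vn] := @fresh _ _ [:: u] uR; first exact: leq_trans s9.
have [|w wR wn] := @fresh _ _ [:: u; v] uR; first exact: leq_trans s9.
have uuvw : uniq [:: u; v; w].
  by move: vn wn; rewrite /= !inE !negb_or => vn wn; split_neq; distinct.
have Cuvw : has_cycle L u v w by apply: Cc; rewrite // mem_cat ?uR1 ?vR ?wR orbT.
move=> x y z xL yL zL uxyz.
apply: (triples_connected (S := R) (X := L) (C := has_cycle L) uR s9
   RL _ _ _ uuvw _ uxyz Cuvw) => //; rewrite ?(RL _ uR1) ?(RL _ vR) ?(RL _ wR) ?xL ?yL ?zL//.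
  by move=> *; exact: has_cycle_rot.
move=> {u v w uR1 vR vn wR wn uuvw Cuvw x y z xL yL zL uxyz} x y z p.
move=> /and4P[xL yL zL pL] uxyzp zpR.
have [|q qR qn] := @fresh _ _ [:: x; y; z; p] uR; first exact: leq_trans s9.
move: uxyzp qn; rewrite /= !inE !negb_or => U V; split_neq.
have [h Hh hc] : has_cycle L z p q.
  have uzpq : uniq [:: z; p; q] by distinct.
  have /orP[zpc|zpb] : (z \in succs c ++ R) && (p \in succs c ++ R) ||
      (z \in succs b ++ R) && (p \in succs b ++ R).
    move: zL pL zpR; rewrite !mem_cat.
    by case: (z \in R); case: (p \in R); rewrite ?orbT //= ?orbF ?andbT ?orbb // orbC.
  - by case/andP: zpc => ? ?; apply: Cc => //; rewrite mem_cat qR orbT.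
  - by case/andP: zpb => ? ?; apply: Cb => //; rewrite mem_cat qR orbT.
have [zp pq qz fh] := hc.
apply: (has_cycle_conj (L := L) Hh _ _ zp).
- by apply: fh => //; distinct.
- by apply: fh => //; distinct.
exact: (maps_onto uL erefl (cycles_maps zL pL (RL _ qR) hc)).
Qed.

Lemma all_cycles_transport L L' : uniq L -> size L = size L' -> has_map L L' ->
  all_cycles L' -> all_cycles L.
Proof.
move=> uL sLL' [h Hh hLL'] TL' x y z xL yL zL.
have [x' x'L' xx] := hLL' _ xL; have [y' y'L' yy] := hLL' _ yL.
have [z' z'L' zz] := hLL' _ zL.
have neq u v u' v' : acts h u u' -> acts h v v' -> u != v -> u' != v'.
  move=> uu vv; apply: contra => /eqP e; rewrite e in uu.
  by rewrite (acts_inj hd uu vv).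
rewrite /= !inE !negb_or => /andP[/andP[xy xz] /andP[yz _]].
apply: (has_cycle_conj (L := L') (HV Hh) (actsV xx) (actsV yy) (actsV zz)).
  by move=> v /hLL'[w wL' vw]; exists w => //; exact: (actsV vw).
apply: TL' => //; rewrite /= !inE !negb_or.
by rewrite (neq _ _ _ _ xx yy)// (neq _ _ _ _ xx zz)// (neq _ _ _ _ yy zz).
Qed.

Lemma size_expand a L : a != vroot -> size (succs a ++ L) = d + size L.
Proof. by move=> a0; rewrite size_cat size_succs. Qed.

(** The property propagated by induction on the size of codes.  Only even
    permutations are asked for, as the sign of a lift is not controlled. *)
Definition flexible M := forall L L', code L -> code L' -> size L = M -> size L' = M ->
  has_map L L' /\ all_cycles L.

(** The 3-cycles make the action on a code transitive, which allows to prescribe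
    the image of one leaf. *)
Lemma has_map_at M a a' L L' : flexible M -> 2 < M -> code (a :: L) -> code (a' :: L') ->
  size (a :: L) = M -> size (a' :: L') = M ->
  exists2 h, H h & acts h a a' /\ maps h L L'.
Proof.
move=> gM M2 cL cL' sL sL'.
suff [h Hh [haa hLL']] : exists2 h, H h & acts h a a' /\ maps h (a :: L) (a' :: L').
  exists h => //; split=> // v vL.
  have [|w] := hLL' v; first by rewrite inE vL orbT.
  rewrite inE => /orP[/eqP -> vw|wL' vw]; last by exists w.
  have /andP[aL _] : (a \notin L) && uniq L := code_uniq cL.
  by move: aL; rewrite -(acts_inj hd vw haa) vL.
have [[h Hh hLL'] _] := gM _ _ cL cL' sL sL'.
have [_ TL'] := gM _ _ cL' cL sL' sL.
have [e eL' ae] := hLL' _ (mem_head _ _).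
have [ea|ea] := eqVneq e a'; first by subst e; exists h.
have [|r rL' rn] := @fresh _ _ [:: e; a'] (code_uniq cL'); first by rewrite sL'.
have [| |||c Hc hc] := TL' e a' r => //; first exact: mem_head.
  by move: rn; rewrite !inE !negb_or => /andP[re ra']; distinct.
exists (c * h)%g; first exact: HM.
have cL'L' := cycles_maps eL' (mem_head _ _) rL' hc.
case: hc => ea' _ _ _; split; first exact: actsM ae ea'.
move=> v /hLL'[w /cL'L'[w' w'L' ww'] vw]; exists w' => //.
exact: actsM vw ww'.
Qed.

(** Collapsing a family of siblings in two codes of size M + (d - 1) gives codes
    of size M; a bijection between these that matches the collapsed leaves
    lifts.  For the 3-cycles the code is moved in this way onto a code with two
    families of siblings.  The bound on M leaves enough room for the pigeonhole
    argument away from both families. *)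
Lemma flexible_step M : k < M -> d`! + 11 + d < M -> flexible M -> flexible (M + d.-1).
Proof.
move=> kM dM gM.
have M2 : 2 < M by lia.
have contract L : code L -> k < size L ->
    exists a L1, [/\ code (a :: L1), perm_eq L (succs a ++ L1) &
                   size L = size (a :: L1) + d.-1].
  move=> cL kL; have [pL|[a [L1 [ca pL]]]] := code_contract cL.
    by move: kL; rewrite (perm_size pL) size_map -cardE card_ord ltnn.
  exists a, L1; split=> //; rewrite (perm_size pL).
  by rewrite size_expand ?(code_neq ca (mem_head _ _))//=; lia.
have kM' : k < M + d.-1 by rewrite ltn_addr.
have glue L L' a a' L1 L1' : perm_eq L (succs a ++ L1) -> perm_eq L' (succs a' ++ L1') ->
    code (a :: L1) -> code (a' :: L1') -> size (a :: L1) = M -> size (a' :: L1') = M ->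
    has_map L L'.
  move=> pL pL' ca ca' sL sL'.
  have [h Hh [haa hLL']] := has_map_at gM M2 ca ca' sL sL'.
  exists h => //; apply: maps_sub (maps_expand haa hLL') => v.
    by rewrite (perm_mem pL).
  by rewrite (perm_mem pL').
move=> L L' cL cL' sL sL'.
have [|a [L1 [ca pL sL1]]] := contract _ cL; first by rewrite sL.
have [|a' [L1' [ca' pL' sL1']]] := contract _ cL'; first by rewrite sL'.
have {}sL1 : size (a :: L1) = M by lia.
have {}sL1' : size (a' :: L1') = M by lia.
split; first exact: glue ca ca' _ _.
have [|c [L2 [cc p1 s1]]] := contract _ ca; first by rewrite sL1.
case: L2 cc p1 s1 => [|b R] cc p1 s1.
  by move: s1; rewrite sL1 /=; lia.
have cc' := code_swap cc.
have cc1 := code_expand_first cc'; have cc2 := code_expand_first cc.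
have sR : size R + d.+1 = M by move: s1; rewrite sL1 /=; lia.
have sB e : e != vroot -> (size (succs e ++ R)).+1 = M.
  by move=> e0; rewrite size_expand//; lia.
have b0 := code_neq cc' (mem_head _ _); have c0 := code_neq cc (mem_head _ _).
have [_ T1] := gM _ _ cc1 cc1 (sB _ b0) (sB _ b0).
have [_ T2] := gM _ _ cc2 cc2 (sB _ c0) (sB _ c0).
have TB : all_cycles (succs b ++ succs c ++ R).
  by apply: two_carets => //; lia.
apply: all_cycles_transport TB.
- exact: code_uniq.
- by rewrite sL size_expand// -(sB _ c0) /=; lia.
- exact: glue pL (perm_refl _) ca cc2 sL1 (sB _ c0).
Qed.

(** The bound exceeds those of [flexible_step] by at least d - 1, so that the
    step applies to the first size beyond it. *)
Lemma flexible_all :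
  (forall M, M <= d`! + 12 + d.*2 + k -> flexible M) -> forall M, flexible M.
Proof.
move=> base M; have [m] := ubnP M; elim: m M => // m IH M.
rewrite ltnS => Mm; have [/base//|lM] := leqP M (d`! + 12 + d.*2 + k).
have dM : d.-1 <= M by lia.
by rewrite -(subnK dM); apply: flexible_step; [lia|lia|apply: IH; lia].
Qed.

End Engine.

(** * Density of flexible subgroups *)

Definition swap (T : eqType) (s t v : T) := if v == s then t else if v == t then s else v.

Lemma swap_inj (T : eqType) (s t : T) : injective (swap s t).
Proof.
apply: (can_inj (g := swap s t)) => v; rewrite /swap.
have [->|vs] := eqVneq v s; first by rewrite eqxx; case: eqVneq.
have [->|vt] := eqVneq v t; first by rewrite eqxx.
by rewrite (negPf vs) (negPf vt).
Qed.

Lemma swap_in (T : eqType) (s t : T) (L : seq T) : s \in L -> t \in L ->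
  {in L, forall v, swap s t v \in L}.
Proof. by move=> sL tL v vL; rewrite /swap; do 2 case: eqP => // _. Qed.

Section Density.
Variables d k : nat.
Hypotheses (hd : 1 < d) (hk : 1 < k).
Implicit Types (u v w x y z : vertex d k) (L R : seq (vertex d k)) (g h c : neretin d k).
Local Notation vroot := (vroot d k).
Variable H : set (neretin d k).
Hypothesis H1 : H 1%g.
Hypothesis HM : forall g h, H g -> H h -> H (g * h)%g.
Hypothesis HV : forall g, H g -> H g^-1%g.

(** Bring the points of r back to their places one after the other, each time by
    a 3-cycle whose third point is s or t and so disturbs no point of r already
    settled. *)
Lemma sort_by_cycles L s t (pi : vertex d k -> vertex d k) (r : seq (vertex d k)) :
  code L -> all_cycles H L -> s \in L -> t \in L -> s != t ->
  {in L, forall v, pi v \in L} -> {in L &, injective pi} ->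
  {subset r <= L} -> s \notin r -> t \notin r ->
  exists2 h, H h & exists pi' : vertex d k -> vertex d k,
    [/\ {in L, forall v, pi' v \in L /\ acts h (pi v) (pi' v)},
        {in L &, injective pi'} & {in r, forall v, pi' v = v}].
Proof.
move=> cL TL sL tL st piL pi_inj; elim: r => [|x r IH] rL sr tr.
  exists 1%g => //; exists pi; split=> // v vL; split; first exact: piL.
  by apply: acts1; exact: code_neq cL (piL _ vL).
have xL : x \in L by apply: rL; rewrite mem_head.
have rL' : {subset r <= L} by move=> v vr; apply: rL; rewrite inE vr orbT.
move: sr tr; rewrite !inE !negb_or => /andP[sx sr] /andP[tx tr].
have [h Hh [pi' [piP pi'_inj fix_r]]] := IH rL' sr tr.
have [pix|pix] := eqVneq (pi' x) x.
  by exists h => //; exists pi'; split=> // v; rewrite inE => /orP[/eqP->|/fix_r].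
set y := pi' x in pix.
have yL : y \in L by have [] := piP _ xL.
have yr : y \notin r.
  apply: contra pix => yr; apply/eqP/pi'_inj => //.
  exact: fix_r.
have [u [uL uy ux ur]] : exists u, [/\ u \in L, u != y, u != x & u \notin r].
  have [sy|sy] := eqVneq s y; last by exists s.
  by exists t; split=> //; rewrite -sy eq_sym.
have [||||c Hc hc] := TL y x u => //.
  by rewrite /= !inE !negb_or pix ![_ == u]eq_sym uy ux.
have /boolp.choice[m mP] : forall v, exists w, v \in L -> w \in L /\ acts c v w.
  move=> v; have [/(cycles_maps yL xL uL hc)[w wL vw]|_] := boolP (v \in L).
    by exists w.
  by exists v.
have [yx xu uy' fc] := hc.
exists (c * h)%g; first exact: HM.
exists (m \o pi'); split.
- move=> v vL /=; have [pi'vL a] := piP _ vL; have [mL b] := mP _ pi'vL.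
  by split=> //; exact: actsM a b.
- move=> v w vL wL /= e; have [pv _] := piP _ vL; have [pw _] := piP _ wL.
  apply: pi'_inj => //; have [_ a] := mP _ pv; have [_ b] := mP _ pw.
  by rewrite e in a; exact (acts_inj hd a b).
move=> v; rewrite inE => /orP[/eqP->|vr] /=.
  by have [_ a] := mP _ yL; exact (acts_fun hd a yx).
have vL := rL' _ vr; rewrite fix_r//; have [_ a] := mP _ vL.
apply: (acts_fun hd a); apply: fc => //; rewrite !inE !negb_or.
have neq w : w \notin r -> v != w by move=> wr; apply: contraNneq wr => <-.
by rewrite !neq//; apply: contra pix => xr; apply/eqP; exact: fix_r.
Qed.

(** The 3-cycles generate the alternating group, which together with any single
    transposition exhausts all permutations. *)
Lemma permutation_or_swap L s t (pi : vertex d k -> vertex d k) :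
  code L -> all_cycles H L -> s \in L -> t \in L -> s != t ->
  {in L, forall v, pi v \in L} -> {in L &, injective pi} ->
  exists2 h, H h & {in L, forall v, acts h v (pi v)} \/
                   {in L, forall v, acts h v (pi (swap s t v))}.
Proof.
move=> cL TL sL tL st piL pi_inj.
pose r := [seq v <- L | (v != s) && (v != t)].
have [|||h Hh [pi' [piP pi'_inj fix_r]]] := sort_by_cycles (r := r) cL TL sL tL st piL pi_inj.
- by move=> v; rewrite mem_filter => /andP[].
- by rewrite mem_filter eqxx.
- by rewrite mem_filter eqxx andbF.
have fixv v : v \in L -> v != s -> v != t -> pi' v = v.
  by move=> vL vs vt; apply: fix_r; rewrite mem_filter vs vt.
have st_img v : v \in L -> (v == s) || (v == t) -> (pi' v == s) || (pi' v == t).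
  move=> vL vst; apply: contraLR vst; rewrite !negb_or => /andP[ps pt].
  have [pL _] := piP _ vL; have := fixv _ pL ps pt => /pi'_inj e.
  by rewrite -e// ps.
exists h^-1%g; first exact: HV.
have [pis|pis] := eqVneq (pi' s) s.
  left => v vL; have [_ a] := piP _ vL; rewrite -{1}(_ : pi' v = v); first exact: actsV.
  have [->//|vs] := eqVneq v s; have [vt|vt] := eqVneq v t; last exact: fixv.
  subst v; have /orP[/eqP pts|/eqP//] : (pi' t == s) || (pi' t == t).
    by apply: st_img; rewrite ?eqxx ?orbT.
  by move: st; rewrite (pi'_inj s t sL tL) ?eqxx// pis.
have pist : pi' s = t.
  have := st_img _ sL; rewrite eqxx => /(_ isT) /orP[/eqP e|/eqP//].
  by rewrite e eqxx in pis.
have pits : pi' t = s.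
  have := st_img _ tL; rewrite eqxx orbT => /(_ isT) /orP[/eqP//|/eqP e].
  by move: st; rewrite (pi'_inj s t sL tL) ?eqxx// pist.
right => v vL; have swL := swap_in sL tL vL; have [_ a] := piP _ swL.
rewrite -{1}(_ : pi' (swap s t v) = v); first exact: actsV.
rewrite /swap; have [->//|vs] := eqVneq v s; have [->//|vt] := eqVneq v t.
exact: fixv.
Qed.

Lemma code_size_gt0 L : code L -> 0 < size L.
Proof.
move=> /code_contract[pL|[a [L1 [ca pL]]]]; rewrite (perm_size pL).
  by rewrite size_map -cardE card_ord; exact: ltnW.
by rewrite size_expand ?(code_neq ca (mem_head _ _))// ltn_addr// ltnW.
Qed.

(** The finite subtree is chosen so large that g acts on its leaves and that it
    contains F.  One of its leaves is then replaced by its children, two of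
    which serve as the transposition s, t: correcting g by this transposition
    stays within the automorphisms of the rooted tree fixing F. *)
Lemma dense_of_flexible : (forall M, flexible H M) -> forall g (F : set (vertex d k)),
  finite_set F -> exists2 b : tree_aut d k, fixing F b & H (g * neretin_incl b)%g.
Proof.
move=> gH g F Ff; pose f := repr g.
have [A0 sA0 FA0] : exists2 A, subtree A & aa_dom f `|` F `<=` A.
  by apply: subtree_hull; rewrite finite_setU; split=> //; exact: finite_dom.
have pA0 : pclosed A0 by exact/subtreeP.
have [L0 lA0] := leaves_exist pA0.
have : code L0 by exists A0.
case: L0 lA0 => [_ /code_size_gt0//|a L1 lA0 cL0].
have [pA lA] := leaves_expand pA0 lA0.
set A := _ `|` _ in pA lA; set L := succs a ++ L1 in lA.
have fA : aa_dom f `<=` A by move=> v fv; left; apply: FA0; left.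
have FA : F `<=` A by move=> v fv; left; apply: FA0; right.
have [uL mL] := lA.
have gf v : v \in L -> acts g v (f v).
  by move=> /mL[Av _]; rewrite -(neretin_repr g); apply: acts_out => /fA.
have cL : code L by exists A.
have cL' := code_image pA lA fA.
have sLL' : size L = size (map f L) by rewrite size_map.
have [[h Hh hLL'] _] := gH _ _ _ cL cL' erefl (esym sLL').
have [_ TL] := gH _ _ _ cL cL erefl erefl.
have onto := maps_onto hd uL sLL' hLL'.
have /boolp.choice[pi piP] : forall v, exists w, v \in L -> w \in L /\ acts h w (f v).
  move=> v; have [/(map_f f)/onto[w wL wv]|_] := boolP (v \in L); first by exists w.
  by exists v.
have pi_inj : {in L &, injective pi}.
  move=> u v uL' vL' e; have [_ a1] := piP _ uL'; have [_ a2] := piP _ vL'.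
  rewrite e in a1; have e' := acts_fun hd a1 a2.
  by have b1 := gf _ uL'; rewrite e' in b1; exact (acts_inj hd b1 (gf _ vL')).
have piL v : v \in L -> pi v \in L by move=> /piP[].
have a0 := code_neq cL0 (mem_head _ _).
have := size_succs a0; case E : (succs a) => [|s [|t D]] //=; [lia|lia|move=> _].
have [sa ta] : s \in succs a /\ t \in succs a by rewrite E !inE !eqxx orbT.
have st : s != t by have := uniq_succs a; rewrite E /= !inE negb_or => /andP[/andP[]].
have [sL tL] : s \in L /\ t \in L by split; exact: mem_catl.
(* On L the actions satisfy g = h pi, so pi has to be realised in H. *)
have [c Hc cpi] := permutation_or_swap cL TL sL tL st piL pi_inj.
have [phi [phiL phi_inj phip cphi]] : exists phi : vertex d k -> vertex d k,
    [/\ {in L, forall v, phi v \in L}, {in L &, injective phi},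
        {in L, forall v, parent (phi v) = parent v} &
        {in L, forall v, acts c v (pi (phi v))}].
  case: cpi => cpi; first by exists id; split.
  exists (swap s t); split=> //; first exact: swap_in.
    by move=> u v _ _; exact: swap_inj.
  move=> v _; rewrite /swap; have [->|_] := eqVneq v s.
    by rewrite !(succs_parent (v := a)).
  by have [->|_] := eqVneq v t => //; rewrite !(succs_parent (v := a)).
have [b bA e] : exists2 b : tree_aut d k, fixing A b & (g^-1 * (h * c))%g = neretin_incl b.
  apply: (tree_aut_of_siblings pA lA phiL phi_inj phip) => v vL.
  have pvL := phiL _ vL; have [_ hf] := piP _ pvL.
  by apply: actsM (actsM (cphi _ vL) hf) _; apply: actsV; exact: gf.
exists b; first by move=> v /FA; exact: bA.
by rewrite -e mulgA mulgV mul1g; exact: HM.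
Qed.

Lemma closed_full : closed H -> (forall M, flexible H M) -> H = setT.
Proof.
move=> cH gH; apply/seteqP; split=> // g _; apply: cH => U /neretin_nbhsP[F Ff FU].
have [b bF Hb] := dense_of_flexible gH g Ff.
by exists (g * neretin_incl b)%g; split=> //; exact: FU.
Qed.

End Density.

(** * A Chabauty neighbourhood of the whole group *)

Section Base.
Variables d k : nat.
Hypotheses (hd : 1 < d).
Implicit Types (u v w x y z : vertex d k) (L R : seq (vertex d k)) (g h c : neretin d k).

Lemma code_depth L v : code L -> v \in L -> depth v <= size L.
Proof.
have [n] := ubnP (size L); elim: n L v => // n IH L v sL cL vL.
have [pL|[a [L1 [ca pL]]]] := code_contract cL.
  have : v \in succs (vroot d k) by rewrite -(perm_mem pL).
  rewrite mem_succs => /depth_child -> /=.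
  by move: vL; case: (L).
have a0 := code_neq ca (mem_head _ _).
have sL1 : size L = d + size L1 by rewrite (perm_size pL) size_expand.
have sa : size (a :: L1) < n by rewrite /=; lia.
have : v \in succs a ++ L1 by rewrite -(perm_mem pL).
rewrite mem_cat => /orP[|vL1].
  rewrite mem_succs => /depth_child ->.
  by have := IH _ _ sa ca (mem_head _ _); rewrite /=; lia.
have : v \in a :: L1 by rewrite inE vL1 orbT.
by move=> /(IH _ _ sa ca) /=; lia.
Qed.

Lemma finite_seqs (T : eqType) (F : set T) n : finite_set F ->
  finite_set [set s : seq T | size s <= n /\ {subset s <= [pred x | `[< F x >]]}].
Proof.
move=> Ff; elim: n => [|n IH].
  by apply: (sub_finite_set _ (finite_set1 [::])) => s [/=]; case: s.
have fX := finite_setX Ff IH.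
apply: (@sub_finite_set _ _ ([set [::]] `|` (fun p => p.1 :: p.2) @` (F `*`
    [set s : seq T | size s <= n /\ {subset s <= [pred x | `[< F x >]]}]))).
  move=> [|x s] [/= sn sF]; [by left|right; exists (x, s) => //=].
  split; first by have := sF x (mem_head _ _) => /asboolP.
  by split=> // y ys; apply: sF; rewrite inE ys orbT.
by rewrite finite_setU; split=> //; exact: finite_image.
Qed.

Definition code_pairs N : set (seq (vertex d k) * seq (vertex d k)) :=
  [set p | [/\ code p.1, code p.2, size p.1 = size p.2 & size p.1 <= N]].

Lemma finite_code_pairs N : finite_set (code_pairs N).
Proof.
pose F : set (vertex d k) := \bigcup_(m in `I_N.+1) [set v | depth v = m].
have Ff : finite_set F.
  by apply: bigcup_finite => [|m _]; [exact: finite_II|exact: finite_level].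
have fS := finite_seqs N Ff.
apply: sub_finite_set (finite_setX fS fS) => -[L L'] [/= cL cL' sLL' sL].
have sub L2 : code L2 -> size L2 <= N -> {subset L2 <= [pred x | `[< F x >]]}.
  move=> c2 s2 v vL; apply/asboolP; exists (depth v) => //=.
  by rewrite ltnS; apply: leq_trans s2; exact: code_depth.
by split; split=> //=; [exact: sub|rewrite -sLL'|apply: sub; rewrite -?sLL'].
Qed.

(** The bijection is encoded by the order of the two lists. *)
Definition table_set (p : seq (vertex d k) * seq (vertex d k)) : set (neretin d k) :=
  [set h | {in p.1, forall v, acts h v (nth v p.2 (index v p.1))}].

(** A tree automorphism fixing the leaves does not change where they go. *)
Lemma table_set_open p : open (table_set p).
Proof.
rewrite openE => h hp; apply/neretin_nbhsP; exists [set` p.1]; first exact: finite_seq.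
move=> b bp v vL; apply: actsM (hp _ vL).
have [v0 _] := acts_neq (hp _ vL).
have := @acts_out d k (mkaa (aa_of_iso b)) v; rewrite mkaa_dom mkaaE bp//.
by apply; exact/eqP.
Qed.

Lemma nth_index_in L L' v : size L = size L' -> v \in L -> nth v L' (index v L) \in L'.
Proof. by move=> e vL; rewrite mem_nth// -e index_mem. Qed.

Lemma table_set_neq0 N p : code_pairs N p -> table_set p !=set0.
Proof.
case: p => L L' [/= cL cL' sLL' _].
have [||h hP] := @table_exists d k L L' (fun v => nth v L' (index v L)) cL cL' sLL'.
- by move=> v; exact: nth_index_in.
- move=> u v uL vL; rewrite (set_nth_default v) -?sLL' ?index_mem// => /eqP.
  rewrite nth_uniq -?sLL' ?index_mem ?(code_uniq cL')// => /eqP e.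
  by rewrite -(nth_index v uL) e nth_index.
by exists h.
Qed.

(** A 3-cycle of a code is itself a bijection between two codes, the second one
    being a reordering of the first. *)
Lemma flexible_of_tables N (H : set (neretin d k)) :
  (forall p, code_pairs N p -> (H `&` table_set p) !=set0) ->
  forall M, M <= N -> flexible H M.
Proof.
move=> Hp M MN L L' cL cL' sL sL'.
have tabs L2 : code L2 -> size L2 = size L -> exists2 h, H h &
    {in L, forall v, acts h v (nth v L2 (index v L))}.
  move=> c2 s2; have [|h [Hh hP]] := Hp (L, L2); last by exists h.
  by split; rewrite //= sL.
split.
  have [|h Hh hP] := tabs L' cL'; first by rewrite sL sL'.
  exists h => // v vL; exists (nth v L' (index v L)); last exact: hP.
  by apply: nth_index_in => //; rewrite sL sL'.
move=> x y z xL yL zL; rewrite /= !inE !negb_or => /andP[/andP[xy xz] /andP[yz _]].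
pose phi := swap x y \o swap y z.
have phiL : {in L, forall v, phi v \in L}.
  by move=> v vL; apply: swap_in => //; exact: swap_in.
have uL := code_uniq cL.
have um : uniq (map phi L).
  by rewrite map_inj_uniq//; apply: inj_comp; exact: swap_inj.
have sub : {subset map phi L <= L} by move=> _ /mapP[v vL ->]; exact: phiL.
have cphi : code (map phi L).
  apply: code_perm cL; rewrite perm_sym; apply: uniq_perm => //.
  by have [|_ e] := uniq_min_size um sub; rewrite ?size_map.
have [|h Hh hP] := tabs _ cphi; first by rewrite size_map.
have hphi v : v \in L -> acts h v (phi v).
  by move=> vL; have := hP _ vL; rewrite (nth_map v) ?index_mem// nth_index.
exists h => //; split.
- by have := hphi _ xL; rewrite /phi /= /swap (negPf xy) (negPf xz) eqxx.
- have := hphi _ yL; rewrite /phi /= /swap eqxx.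
  by rewrite (eq_sym z) (negPf xz) (eq_sym z) (negPf yz).
- have := hphi _ zL; rewrite /phi /= /swap eqxx (eq_sym z) (negPf yz) eqxx.
  by rewrite (eq_sym y) (negPf xy).
move=> v vL; rewrite !inE !negb_or => /and3P[vx vy vz].
by have := hphi _ vL; rewrite /phi /= /swap (negPf vy) (negPf vz) (negPf vx) (negPf vy).
Qed.

End Base.

Lemma chabauty_open_nbhs (G : topologicalGroupType) (U : set G) (H : closed_subgroup G) :
  open U -> csub_set H `&` U !=set0 ->
  nbhs H [set K : closed_subgroup G | csub_set K `&` U !=set0].
Proof.
move=> oU HU; apply: open_nbhs_nbhs; split=> //; pose S := chabauty_subbase (true, U).
exists [set S]; last by rewrite bigcup_set1.
by move=> _ ->; exact: (@finI_from1 _ _ (@chabauty_index G) (@chabauty_subbase G) (true, U)).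
Qed.

Lemma closed_subgroup_eq (G : topologicalGroupType) (H K : closed_subgroup G) :
  csub_set H = csub_set K -> H = K.
Proof.
case: H K => H gH cH [K gK cK] /= e; subst K.
by rewrite (Prop_irrelevance gH gK) (Prop_irrelevance cH cK).
Qed.

Theorem corollary4p10 (d k : nat) (hd : (2 <= d)%N) (hk : (2 <= k)%N) :
  isolated [set: closed_subgroup (neretin d k)] (full_subgroup (neretin d k)).
Proof.
split; first exact/mem_set.
pose P := @code_pairs d k (d`! + 12 + d.*2 + k).
exists (\bigcap_(p in P)
  [set K : closed_subgroup (neretin d k) | csub_set K `&` table_set p !=set0]).
  have [D DP] := finite_fsetP.1 (finite_code_pairs k hd (d`! + 12 + d.*2 + k)).
  rewrite /P DP; apply: filter_bigI => p pD.
  have Pp : P p by rewrite /P DP.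
  apply: chabauty_open_nbhs; first exact: table_set_open.
  by rewrite setTI; exact: table_set_neq0 Pp.
rewrite setIT; apply/seteqP; split=> [K HK|_ ->] /=; last first.
  by move=> p Pp /=; rewrite setTI; exact: table_set_neq0 Pp.
apply: closed_subgroup_eq => /=; have [H1 HV'] := csub_group K.
have HV g : csub_set K g -> csub_set K g^-1%g.
  by move=> /mem_set Kg; apply/set_mem; rewrite -[g^-1%g]mul1g; exact: HV'.
have HM g h : csub_set K g -> csub_set K h -> csub_set K (g * h)%g.
  move=> Kg /HV/mem_set Kh; apply/set_mem; rewrite -[h]invgK.
  by apply: HV' => //; exact/mem_set.
apply: (closed_full hd hk (set_mem H1) HM HV); first exact: csub_closed.
by apply: (flexible_all hd HM HV) => M MN; exact: (flexible_of_tables HK MN).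
Qed.
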